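(* Two countable locally finite-by-abelian groups $G,H$ are coarsely equivalent if and only if $\mathrm{asdim}(G)=\mathrm{asdim}(H)$ and the groups $G,H$ are either both finitely generated or both infinitely generated (i.e. not finitely generated).
   Context: Countable groups are endowed with proper left-invariant metrics (a metric is proper if all its closed balls are compact); such a metric exists on every countable group and is unique up to coarse equivalence. A group is finite-by-abelian if it contains a finite normal subgroup with abelian quotient; it is locally finite-by-abelian if each of its finitely generated subgroups is finite-by-abelian. A map $f:X\to Y$ between metric spaces is bornologous if for every $\delta<\infty$ the number $\sup\{\mathrm{diam}(f(A)):A\subset X,\ \mathrm{diam}(A)\le\delta\}$ is finite. Metric spaces $X,Y$ are coarsely equivalent if there are bornologous maps $f:X\to Y$, $g:Y\to X$ and a real constant $K$ with $\mathrm{dist}(g\circ f(x),x)\le K$ and $\mathrm{dist}(f\circ g(y),y)\le K$ for all $x\in X$, $y\in Y$. For a metric space $X$, $\mathrm{asdim}(X)\le n$ means that for every $D\in[0,\infty)$ there is a cover $\mathcal U$ of $X$ with $\sup_{U\in\mathcal U}\mathrm{diam}(U)<\infty$ that can be written as $\mathcal U=\mathcal U_0\cup\dots\cup\mathcal U_n$, where each $\mathcal U_i$ is $D$-discrete, i.e. $\inf\{\mathrm{dist}(u,v):u\in U,v\in V\}\ge D$ for any distinct $U,V\in\mathcal U_i$. The asymptotic dimension $\mathrm{asdim}(X)$ is the smallest integer $n\ge 0$ with $\mathrm{asdim}(X)\le n$, and $\mathrm{asdim}(X)=\infty$ if there is no such $n$. *)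

(* Defs.v *)
From HB Require Import structures.
From mathcomp Require Import all_boot all_order all_algebra.
From mathcomp Require Import all_classical all_reals ereal topology.

Set Implicit Arguments.
Unset Strict Implicit.
Unset Printing Implicit Defensive.

Import Order.TTheory GRing.Theory Num.Theory.

Local Open Scope classical_set_scope.
Local Open Scope ring_scope.
Local Open Scope ereal_scope.

(* Subgroups of a (possibly infinite) group are handled as classical sets. *)
Definition subgroup (G : groupType) (K : set G) : Prop := group_closed [in K].

Definition generated_subgroup (G : groupType) (S : set G) : set G :=
  smallest (@subgroup G) S.

Definition finitely_generated (G : groupType) (K : set G) : Prop :=
  exists2 S : set G, finite_set S & generated_subgroup S = K.

Definition normal_subgroup (G : groupType) (N K : set G) : Prop :=
  [/\ subgroup N, N `<=` K & forall k n, K k -> N n -> N (n ^ k)%g].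

Definition set_mulg (G : groupType) (A B : set G) : set G :=
  [set (a * b)%g | a in A & b in B].

(* The elements of K / N are the cosets xN with x in K. When N is normal in K,
   the group law of K / N is the setwise product set_mulg. *)
Definition quotient_set (G : groupType) (K N : set G) : set (set G) :=
  [set set_mulg [set x] N | x in K].

Definition abelian_quotient (G : groupType) (K N : set G) : Prop :=
  forall A B, quotient_set K N A -> quotient_set K N B ->
    set_mulg A B = set_mulg B A.

Definition finite_by_abelian (G : groupType) (K : set G) : Prop :=
  exists N : set G,
    [/\ normal_subgroup N K, finite_set N & abelian_quotient K N].

Definition locally_finite_by_abelian (G : groupType) : Prop :=
  forall K : set G, subgroup K -> finitely_generated K -> finite_by_abelian K.

(* The union with [set 0] only matters for A = set0: it makes diam set0 = 0,
   since the supremum of the empty set in \bar R is -oo. *)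
Definition diam (R : realType) (X : metricType R) (A : set X) : \bar R :=
  ereal_sup ([set 0] `|` [set (mdist x y)%:E | x in A & y in A]).

Definition bornologous (R : realType) (X Y : metricType R) (f : X -> Y) : Prop :=
  forall delta : R,
    ereal_sup [set diam (f @` A) | A in [set A | diam A <= delta%:E]] < +oo.

Definition coarsely_equivalent (R : realType) (X Y : metricType R) : Prop :=
  exists (f : X -> Y) (g : Y -> X) (K : R),
    [/\ bornologous f, bornologous g,
        forall x, (mdist (g (f x)) x <= K)%R &
        forall y, (mdist (f (g y)) y <= K)%R].

Definition set_dist (R : realType) (X : metricType R) (A B : set X) : \bar R :=
  ereal_inf [set (mdist u v)%:E | u in A & v in B].

Definition discrete_family (R : realType) (X : metricType R) (D : R)
    (U : set (set X)) : Prop :=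
  forall A B, U A -> U B -> A <> B -> D%:E <= set_dist A B.

Definition asdim_le (R : realType) (X : metricType R) (n : nat) : Prop :=
  forall D : R, (0 <= D)%R ->
    exists (U : set (set X)) (V : 'I_n.+1 -> set (set X)),
      [/\ \bigcup_(A in U) A = [set: X],
          ereal_sup [set diam A | A in U] < +oo,
          U = \bigcup_i V i &
          forall i, discrete_family D (V i)].

Definition asdim (R : realType) (X : metricType R) : \bar nat :=
  if pselect (exists n, `[< asdim_le X n >]) is left ex
  then (ex_minn ex)%:E else +oo.

#[short(type="metricGroupType")]
HB.structure Definition MetricGroup (R : numDomainType) :=
  {G of Group G & Metric R G}.

Definition left_invariant (R : realType) (G : metricGroupType R) : Prop :=
  forall g x y : G, mdist (g * x)%g (g * y)%g = mdist x y.

(* The library's closed_ball is the closure of the open ball, which can be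
   smaller than the metric closed ball used here. *)
Definition proper_metric (R : realType) (X : metricType R) : Prop :=
  forall (x : X) (r : R), compact [set y | (mdist x y <= r)%R].

(* Main.v *)
From HB Require Import structures.
From mathcomp Require Import all_boot all_order all_algebra fingroup perm.
From mathcomp Require Import zify ring lra.
From mathcomp Require Import all_classical all_reals ereal topology.
Require Import Defs.

(* Write G as the union of an increasing tower of finitely generated subgroups
   K_n, all finite-by-abelian, such that every left coset of K_n in K_(n+1) is
   indexed by one digit, ranging over Z when the index is infinite and over
   [0, a) when it is finite. Since conjugacy classes in K_n are finite, the
   resulting coordinates identify G, up to coarse equivalence, with a set of
   finitely supported sequences of integers, where two sequences are close when
   they agree far away and differ by a bounded amount elsewhere. Steps of
   infinite index are taken as long as possible. If they never run out, G is
   coarsely equivalent to a direct sum of infinitely many copies of Z. Otherwise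
   there are r of them, and G is coarsely equivalent to Z^r if it is finitely
   generated, and else to the product of Z^r with an infinite homogeneous
   ultrametric space with finite balls, that is, the natural numbers with their
   partitions into blocks of size A_n, for an unbounded divisor chain A.

   All these ultrametric spaces are coarsely equivalent: interleave two divisor
   chains after passing to subsequences of fast growth. If a is large with
   respect to mu, then there are two consecutive integers s such that a is a sum
   of s terms equal to mu or mu + 1. Therefore two shapes of blocks at each level
   suffice to build a relation between the two trees of blocks by concatenation.

   It remains to see that r is the asymptotic dimension. The upper bound uses
   coloured bricks in Z^r. For the lower bound, a cover of Z^n by n discrete
   bounded families gives a map p at bounded distance from the identity which
   takes equal values at two vertices of each simplex of the Kuhn triangulation.
   Modify p to be the identity outside of a large box: the sum of the signed
   volumes of the images of the simplices does not change if p is replaced by the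
   identity, whereas only simplices close to the boundary of the box contribute
   for p, which is too few. *)

Set Implicit Arguments.
Unset Strict Implicit.
Unset Printing Implicit Defensive.

Import Order.TTheory GRing.Theory Num.Theory.

Local Open Scope classical_set_scope.
Local Open Scope ring_scope.

(** * Asymptotic dimension of the integer lattice *)

(* In the Kuhn simplex attached to [x] and [s], one walks from [x] in the
   direction [e l] at time [s l]; this is the position at time [j]. *)
Definition path_vertex (T : zmodType) n (e : 'I_n -> T) (x : T) (s : 'S_n)
    (j : nat) : T := x + \sum_(l | (s l < j)%N) e l.

(* Its determinant is, up to a constant, the signed volume of the simplex whose
   vertices are the columns of [g]. *)
Definition cone_matrix n (g : 'I_n -> 'I_n.+1 -> int) : 'M[int]_n.+1 :=
  \matrix_(i, j) if unlift ord0 i is Some l then g l j else 1.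

Definition path_matrix (T : zmodType) n (e : 'I_n -> T) (f : T -> 'I_n -> int)
    (x : T) (s : 'S_n) : 'M[int]_n.+1 :=
  cone_matrix (fun l j => f (path_vertex e x s j) l).

(** The minor at the row of ones and column [j]: up to a constant, the signed volume of the cone
    from the origin over the facet opposite to vertex [j]. *)
Definition path_facet (T : zmodType) n (e : 'I_n -> T) (f : T -> 'I_n -> int)
    (x : T) (s : 'S_n) (j : 'I_n.+1) : int :=
  \det (\matrix_(l, c) f (path_vertex e x s (lift j c)) l).

Lemma det_path_matrix (T : zmodType) n (e : 'I_n -> T) f x (s : 'S_n) :
  \det (path_matrix e f x s) = \sum_(j < n.+1) (-1) ^+ j * path_facet e f x s j.
Proof.
rewrite (expand_det_row _ ord0); apply: eq_bigr => j _.
rewrite mxE unlift_none mul1r /cofactor add0n; congr (_ * \det _).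
by apply/matrixP => l c; rewrite !mxE liftK.
Qed.

Lemma path_vertex_tperm (T : zmodType) n (e : 'I_n -> T) x (s : 'S_n)
    (i i' : 'I_n) (j : nat) : i' = i.+1 :> nat -> j != i' ->
  path_vertex e x (s * tperm i i')%g j = path_vertex e x s j.
Proof.
move=> ii' ji; congr (_ + _); apply: eq_bigl => l; rewrite permM.
case: tpermP => // ->; first by lia.
rewrite ii'; lia.
Qed.

(** Exchanging the times [j - 1] and [j] reverses the sign of [s] and moves only vertex [j] of the
    path, which is the one left out of the facet. Hence the sum equals its opposite. *)
Lemma sum_sign_facet_inner (T : zmodType) n (e : 'I_n -> T) f x
    (j : 'I_n.+1) : (0 < j < n)%N ->
  \sum_(s : 'S_n) (-1) ^+ s * path_facet e f x s j = 0.
Proof.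
case/andP=> j0 jn.
have j1 : (j.-1 < n)%N by lia.
pose i := Ordinal j1; pose i' := Ordinal jn.
have ii' : i' = i.+1 :> nat by rewrite /= prednK.
have neq : i != i' by rewrite -val_eqE /=; lia.
set S := \sum_s _.
have : S = - S.
  rewrite {1}/S (reindex_inj (mulIg (tperm i i'))) /= -sumrN.
  apply: eq_bigr => s _; rewrite odd_permM odd_tperm neq addbT signrN mulNr.
  congr (- (_ * \det _)); apply/matrixP => l c; rewrite !mxE.
  by rewrite path_vertex_tperm //= eq_sym neq_bump.
by move/eqP; rewrite -addr_eq0 -mulr2n mulrn_eq0 => /eqP.
Qed.

(** The cyclic permutation with 0 sent to [n] and [k + 1] to [k]. Composing [s] with it postpones
    the first step of the walk to the end, so that a path without its first vertex becomes a path
    without its last one. *)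
Definition rot_perm n : 'S_n.+1 := lift_perm ord0 ord_max 1.

Lemma path_vertex_rot (T : zmodType) n (e : 'I_n.+1 -> T) x (s : 'S_n.+1) j :
  (j < n.+1)%N ->
  path_vertex e x s j.+1 =
  path_vertex e (x + e ((s^-1)%g ord0)) (s * rot_perm n)%g j.
Proof.
move=> jn; rewrite /path_vertex -addrA; congr (_ + _).
rewrite (bigD1 ((s^-1)%g ord0)) /= ?permKV //; congr (_ + _).
apply: eq_bigl => l; rewrite permM.
have -> : (l != (s^-1)%g ord0) = (s l != ord0).
  by congr (~~ _); apply/eqP/eqP => [->|<-]; rewrite ?permKV ?permK.
case: (unliftP ord0 (s l)) => [k|] ->.
  rewrite /rot_perm lift_perm_lift perm1 lift_max.
  by rewrite eq_sym neq_lift andbT.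
by rewrite /rot_perm lift_perm_id eqxx andbF /=; lia.
Qed.

Lemma path_facet_rot (T : zmodType) n (e : 'I_n.+1 -> T) f x (s : 'S_n.+1) :
  path_facet e f x s ord0 =
  path_facet e f (x + e ((s^-1)%g ord0)) (s * rot_perm n)%g ord_max.
Proof.
congr (\det _); apply/matrixP => l c; rewrite !mxE.
by rewrite lift0 lift_max path_vertex_rot.
Qed.

(* Inner facets cancel in pairs, and the first facet of a simplex is the last
   facet of another one, with a sign that makes the sums over [x] cancel. *)
Lemma sum_sign_det_path (T : finZmodType) n (e : 'I_n.+1 -> T) f :
  \sum_(x : T) \sum_(s : 'S_n.+1) (-1) ^+ s * \det (path_matrix e f x s) = 0.
Proof.
under eq_bigr => x _.
  under eq_bigr => s _.
    rewrite det_path_matrix big_ord_recl big_ord_recr /=.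
    rewrite expr0 mul1r !mulrDr.
  over.
  rewrite !big_split /=.
  under [X in _ + (X + _)]eq_bigr => s _ do rewrite mulr_sumr.
  rewrite [X in _ + (X + _)]exchange_big /=.
  rewrite [X in _ + (X + _)]big1 ?add0r; last first.
    move=> i _; under eq_bigr => s _ do rewrite mulrCA.
    rewrite -mulr_sumr sum_sign_facet_inner ?mulr0 //= /bump /=.
    by rewrite add1n ltnS ltn_ord.
over.
rewrite big_split /= exchange_big /=.
rewrite [X in _ + X]exchange_big /=.
rewrite [X in _ + X](reindex_inj (mulIg (rot_perm n))) /= -big_split /=.
apply: big1 => s _; rewrite -!mulr_sumr odd_permM odd_lift_perm odd_perm1.
rewrite addbF /= signr_addb.
have -> : lift ord0 (@ord_max n) = ord_max by apply: val_inj; rewrite /= /bump.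
rewrite /bump /=.
under eq_bigr => x _ do rewrite path_facet_rot.
rewrite -(reindex_inj (h := fun x => x + e ((s^-1)%g ord0)) (P := xpredT)
  (F := fun x => path_facet e f x (s * rot_perm n)%g ord_max)); last exact: addIr.
(* The rotation has sign [(-1) ^+ n] and the last facet carries [(-1) ^+ n.+1], so the two sums are
   opposite. *)
rewrite signr_odd exprS mulN1r mulNr mulrN -mulrA [_ * (_ * \sum_i _)]mulrA.
by rewrite -exprD addnn -[(-1) ^+ n.*2]signr_odd odd_double mul1r subrr.
Qed.

(** Volumes are invariant under translation: the unitriangular matrix [B] subtracts multiples of the
    row of ones from the other rows. *)
Lemma det_cone_translate n (g : 'I_n -> 'I_n.+1 -> int) (v : 'I_n -> int) :
  \det (cone_matrix (fun l j => g l j - v l)) = \det (cone_matrix g).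
Proof.
pose B : 'M[int]_n.+1 := \matrix_(i, j) ((i == j)%:R -
  if unlift ord0 i is Some l then (j == ord0)%:R * v l else 0).
have -> : cone_matrix (fun l j => g l j - v l) = B *m cone_matrix g.
  apply/matrixP => i j; rewrite !mxE.
  under eq_bigr => k _ do rewrite !mxE mulrBl.
  rewrite sumrB (bigD1 i) //= big1 ?addr0; last first.
    by move=> k ki; rewrite eq_sym (negPf ki) mul0r.
  rewrite eqxx mul1r (bigD1 ord0) //= big1 ?addr0; last first.
    move=> k k0; case: unlift => [l|]; last by rewrite mul0r.
    by rewrite (negPf k0) !mul0r.
  rewrite ?eqxx unlift_none mulr1; case: unlift => [l|]; last by rewrite subr0.
  by rewrite mul1r.
have trigB : is_trig_mx B.
  apply/is_trig_mxP => i j ij; rewrite mxE.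
  have /negPf -> : i != j by rewrite -val_eqE /= ltn_eqF.
  case: unlift => [l|]; last by rewrite subr0.
  have /negPf -> : j != ord0 by rewrite -val_eqE /=; lia.
  by rewrite mul0r subr0.
rewrite det_mulmx (det_trig trigB) big1 ?mul1r // => i _.
rewrite mxE eqxx; case: unliftP => [l ->|_]; rewrite ?subr0 //.
by rewrite eq_sym (negPf (neq_lift _ _)) mul0r subr0.
Qed.

(** This is the Kuhn simplex of [s] based at the origin, a row permutation of the upper triangular
    matrix of ones. Multiplied by the sign of [s], each such simplex counts for 1. *)
Lemma det_cone_staircase n (s : 'S_n) :
  \det (cone_matrix (fun l j => (s l < j)%N%:R)) = (-1) ^+ s.
Proof.
pose U : 'M[int]_n.+1 := \matrix_(i, j) (i <= j)%N%:R.
have -> : cone_matrix (fun l j => (s l < j)%N%:R) =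
          row_perm (lift_perm ord0 ord0 s) U.
  apply/matrixP => i j; rewrite !mxE; case: unliftP => [l|] ->.
    by rewrite lift_perm_lift lift0.
  by rewrite lift_perm_id.
rewrite row_permE det_mulmx det_perm odd_lift_perm /=.
have trigU : is_trig_mx U^T.
  by apply/is_trig_mxP => i j ij; rewrite !mxE leqNgt ij.
by rewrite -(det_tr U) (det_trig trigU) big1 ?mulr1 // => i _; rewrite !mxE leqnn.
Qed.

Lemma det_cone_le n (g : 'I_n -> 'I_n.+1 -> int) (C : nat) : (0 < C)%N ->
  (forall l j, `|g l j| <= C%:Z) ->
  `|\det (cone_matrix g)| <= ((n.+1)`! * C ^ n.+1)%N%:Z.
Proof.
move=> C0 gC; rewrite /determinant.
apply: le_trans (ler_norm_sum _ _ _) _.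
have -> : ((n.+1)`! * C ^ n.+1)%N%:Z = \sum_(s : 'S_n.+1) C%:Z ^+ n.+1.
  by rewrite sumr_const card_Sn PoszM -rmorphXn /= -mulr_natl natz.
apply: ler_sum => s _; rewrite normrMsign normr_prod.
rewrite -[X in C%:Z ^+ X]card_ord -prodr_const; apply: ler_prod => i _.
rewrite normr_ge0 mxE; case: unlift => [l|]; first exact: gC.
by rewrite normr1; lia.
Qed.

Lemma det_cone_degenerate n (g : 'I_n -> 'I_n.+1 -> int) (i j : 'I_n.+1) :
  i != j -> g^~ i =1 g^~ j -> \det (cone_matrix g) = 0.
Proof.
move=> ij gij; rewrite -det_tr; apply: (determinant_alternate ij) => k.
by rewrite !mxE; case: unlift => [l|//]; exact: gij.
Qed.

(** The boundary layer of a large cube is of lower order than the cube itself. *)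
Lemma expn_add2_le a k : ((a + 2) ^ k.+1 <= a ^ k.+1 + 2 * k.+1 * (a + 2) ^ k)%N.
Proof.
elim: k => [|k IHk]; first by rewrite !expn1 expn0; lia.
have : (a ^ k.+1 <= (a + 2) ^ k.+1)%N by rewrite leq_exp2r ?leq_addr.
move: IHk; rewrite !expnS.
set u := ((a + 2) ^ k)%N; set v := (a ^ k)%N; nia.
Qed.

(* Declares {ffun aT -> rT} to be a finZmodType when rT is one. *)
HB.saturate finfun_of.

(** A finite torus replaces the lattice, because the cancellation of facets needs a sum over all
    base points of a finite group. *)
Definition torus_unit n a (l : 'I_n) : {ffun 'I_n -> 'I_a.+2} :=
  [ffun k => (k == l)%:R].

Lemma torus_vertexE n a (x : {ffun 'I_n -> 'I_a.+2}) (s : 'S_n) j k :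
  path_vertex (@torus_unit n a) x s j k = x k + (s k < j)%N%:R.
Proof.
rewrite /path_vertex ffunE sum_ffunE; congr (_ + _).
under eq_bigr => l _ do rewrite ffunE.
case skj: (s k < j)%N; last first.
  by rewrite big1 // => l slj; case: eqP => // kl; rewrite kl slj in skj.
by rewrite (bigD1 k) //= eqxx big1 ?addr0 // => l /andP[_ /negPf]; rewrite eq_sym => ->.
Qed.

Lemma val_torus_vertex n a (x : {ffun 'I_n -> 'I_a.+2}) (s : 'S_n) j k :
  (x k < a.+1)%N -> path_vertex (@torus_unit n a) x s j k = (x k + (s k < j))%N :> nat.
Proof.
move=> xk; rewrite torus_vertexE; case: (s k < j)%N; last by rewrite addr0 addn0.
by rewrite /= (modn_small (m := 1)) // modn_small //; lia.
Qed.

(** A simplex that wraps around in direction [k] has all its vertices on the two extreme faces of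
    the box in that direction. A map that is the identity off the open box is thus the identity on
    its vertices. *)
Lemma val_torus_vertex_wrap n a (x : {ffun 'I_n -> 'I_a.+2}) (s : 'S_n) j k :
  x k = a.+1 :> nat ->
  (path_vertex (@torus_unit n a) x s j k : nat) \in [:: 0%N; a.+1].
Proof.
move=> xk; rewrite torus_vertexE; case: (s k < j)%N; last by rewrite addr0 xk !inE eqxx orbT.
by rewrite /= xk (modn_small (m := 1)) // addn1 modnn.
Qed.

Lemma card_ffun_pred (aT rT : finType) (P : pred rT) :
  #|[pred x : {ffun aT -> rT} | [forall k, P (x k)]]| = (#|P| ^ #|aT|)%N.
Proof.
rewrite -card_ffun_on; apply: eq_card => x; rewrite !inE.
exact/forallP/ffun_onP.
Qed.

Lemma card_ord_lt n m : (m <= n)%N -> #|[pred i : 'I_n | (i < m)%N]| = m.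
Proof.
move=> mn; rewrite -sum1_card -[RHS]card_ord -sum1_card /=.
rewrite (big_ord_widen n (fun=> 1%N)) //; exact: eq_bigl.
Qed.

Lemma card_ord_gap a : #|[pred i : 'I_a.+3 | (0 < i < a.+1)%N]| = a.
Proof.
have := @card_ord_lt a.+3 a.+1 (leqW (leqnSn _)).
rewrite (cardD1 ord0) inE /= add1n => -[card_a].
rewrite -[RHS]card_a.
by apply: eq_card => i; rewrite !inE -val_eqE /= -lt0n.
Qed.

Lemma no_degenerate_labelling n (m : nat) (c : {ffun 'I_n.+1 -> int} -> 'I_n.+1)
    (p : {ffun 'I_n.+1 -> int} -> {ffun 'I_n.+1 -> int}) :
  (forall x l, `|p x l - x l| <= m%:Z) ->
  (forall x y, c x = c y -> (forall l, `|x l - y l| <= 1) -> p x = p y) ->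
  False.
Proof.
move=> pm pc.
(* [D] bounds the determinant of a simplex, taken relative to its base point, when vertices are
   displaced by at most [m]. The side [a] is so large that [(D + 1) * a ^ (n + 1)] exceeds
   [D * (a + 2) ^ (n + 1)]. *)
pose D := ((n.+2)`! * (m + 2) ^ n.+2)%N.
pose a := (2 * n.+1 * D.+2)%N.
pose T : finZmodType := ({ffun 'I_n.+1 -> 'I_a.+3} : Type).
pose e : 'I_n.+1 -> T := @torus_unit n.+1 a.+1.
pose iota (x : T) : {ffun 'I_n.+1 -> int} := [ffun l => (x l : nat)%:Z].
pose Q (x : T) := [forall l, 0 < (x l : nat) < a.+2]%N.
pose f (x : T) l : int := if Q x then p (iota x) l else iota x l.
pose g (x : T) l : int := iota x l.
pose sg x (s : 'S_n.+1) h : int := (-1) ^+ s * \det (path_matrix e h x s).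
have vtxE (x : T) (s : 'S_n.+1) j k : (x k < a.+2)%N ->
    path_vertex e x s j k = (x k + (s k < j))%N :> nat.
  exact: val_torus_vertex.
have iotaE x l : iota x l = (x l : nat)%:Z by rewrite ffunE.
have zero h : \sum_(x : T) \sum_s sg x s h = 0 by exact: sum_sign_det_path.
(* [J] collects the base points whose simplices do not wrap around, and [I] those whose simplices
   have all vertices in the open box [Q]. *)
pose J := [pred x : T | [forall l, ((x l : nat) < a.+2)%N]].
pose I := [pred x : T | [forall l, (0 < (x l : nat) < a.+1)%N]].
have IJ x : I x -> J x.
  move=> /forallP Ix; apply/forallP => l; case/andP: (Ix l) => _ /leq_trans; exact.
have sg1 x s : J x -> sg x s g = 1.
  move=> /forallP Jx; rewrite /sg /path_matrix.
  rewrite -(det_cone_translate _ (fun l => iota x l)).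
  rewrite -[RHS](sqrr_sign int s) expr2; congr (_ * _).
  rewrite -det_cone_staircase; congr (\det _); apply/matrixP => i j; rewrite !mxE.
  case: unlift => // l; rewrite /g !iotaE vtxE ?PoszD; last exact: Jx.
  by rewrite addrAC subrr add0r; case: (_ < _)%N.
have sgI x s : I x -> sg x s f = 0.
  move=> /[dup] /IJ /forallP Jx /forallP Ix.
  pose v (j : 'I_n.+2) : T := path_vertex e x s j.
  have Qv j : Q (v j).
    apply/forallP => l; rewrite vtxE; last exact: Jx.
    by have := Ix l; case: (s l < j)%N => /=; lia.
  have /injectivePn [j [j' jj' cjj']] : ~~ injectiveb (fun j => c (iota (v j))).
    by apply/negP => /injectiveP /leq_card; rewrite !card_ord ltnn.
  rewrite /sg (@det_cone_degenerate _ _ j j') ?mulr0 // => l.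
  rewrite /f !Qv; apply: (congr1 (fun h : {ffun _} => h l)); apply: pc => // k.
  rewrite !iotaE !vtxE; try exact: Jx.
  by case: (s k < j)%N; case: (s k < j')%N => /=; lia.
have sgW x s : ~~ J x -> sg x s f = sg x s g.
  rewrite negb_forall => /existsP [k xk].
  have {}xk : x k = a.+2 :> nat by have := ltn_ord (x k); lia.
  congr (_ * \det _); apply/matrixP => i j; rewrite !mxE.
  case: unlift => // l; rewrite /f /g; case: ifP => // /forallP /(_ k).
  have := @val_torus_vertex_wrap n.+1 a.+1 x s j k xk.
  by rewrite !inE => /orP [] /eqP ->; rewrite ?ltnn ?andbF.
have sgB x s : J x -> sg x s f <= D%:Z.
  move=> /forallP Jx; apply: le_trans (ler_norm _) _.
  rewrite normrMsign /path_matrix -(det_cone_translate _ (fun l => iota x l)).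
  apply: det_cone_le => [|l j]; first by lia.
  have near_x : `|iota (path_vertex e x s j) l - iota x l| <= 1.
    rewrite !iotaE vtxE ?PoszD; last exact: Jx.
    by rewrite addrAC subrr add0r; case: (_ < _)%N.
  rewrite /f; case: ifP => _; last by lia.
  have := pm (iota (path_vertex e x s j)) l; lia.
have IJcard : (#|I| = a ^ n.+1)%N /\ (#|J| = a.+2 ^ n.+1)%N.
  split.
    by rewrite -[in RHS](card_ord n.+1) -[in RHS](card_ord_gap a) -card_ffun_pred.
  rewrite -[in RHS](card_ord n.+1) -[in RHS](@card_ord_lt a.+3 a.+2) //.
  by rewrite -card_ffun_pred.
(* Both maps have total 0. Passing from the identity [g] to [f] loses 1 for each simplex based in
   [I], gains at most [D] for the others based in [J], and changes nothing elsewhere. *)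
have : 0 <= \sum_(x : T) (D%:Z * (J x)%:R - D.+1%:Z * (I x)%:R).
  have : 0 <= (\sum_(x : T) (D%:Z * (J x)%:R - D.+1%:Z * (I x)%:R)) *+ (n.+1)`!.
    have E0 : \sum_(x : T) \sum_s (sg x s f - sg x s g) = 0.
      by under eq_bigr => x _ do rewrite sumrB; rewrite sumrB !zero subrr.
    rewrite -[X in X <= _]E0 -sumrMnl.
    apply: ler_sum => x _; rewrite -card_Sn -sumr_const.
    apply: ler_sum => s _; have [Ix|nIx] := boolP (I x).
      rewrite sgI // sg1 ?IJ //=; lia.
    have [Jx|nJx] := boolP (J x); last by rewrite sgW //; lia.
    by have := sgB x s Jx; rewrite sg1 //; lia.
  by rewrite pmulrn_lge0 // fact_gt0.
rewrite sumrB -!mulr_sumr -!natr_sum.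
have -> : (\sum_(x : T) J x = #|J|)%N.
  rewrite -sum1_card [RHS]big_mkcond; apply: eq_bigr => x _.
  by have -> : (x \in J) = J x by []; case: (J x).
have -> : (\sum_(x : T) I x = #|I|)%N.
  rewrite -sum1_card [RHS]big_mkcond; apply: eq_bigr => x _.
  by have -> : (x \in I) = I x by []; case: (I x).
case: IJcard => -> ->; rewrite subr_ge0 !natz -!PoszM lez_nat => le1.
have := expn_add2_le a n; rewrite addn2 => le2.
have : (0 < a.+2 ^ n)%N by rewrite expn_gt0.
move: le1 le2; rewrite !(expnS a.+2); move: (a ^ n.+1)%N (a.+2 ^ n)%N => u v.
rewrite /a; nia.
Qed.

(** * Coarse structures given by sequences of scales *)

(** [E n x y] stands for a distance of at most [n]. Metrics, trees of blocks and digit sequences are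
    compared in this common language. *)
Definition scales (X : Type) := nat -> X -> X -> Prop.

Definition coarse_scales X (E : scales X) : Prop :=
  [/\ forall n x, E n x x, forall n x y, E n x y -> E n y x,
      forall m n x y, (m <= n)%N -> E m x y -> E n x y &
      forall m n, exists k, forall x y z, E m x y -> E n y z -> E k x z].

Definition controlled X Y (E : scales X) (F : scales Y) (f : X -> Y) : Prop :=
  forall n, exists m, forall x y, E n x y -> F m (f x) (f y).

Definition expansive X Y (E : scales X) (F : scales Y) (f : X -> Y) : Prop :=
  forall n, exists m, forall x y, F n (f x) (f y) -> E m x y.

Definition cobounded X Y (F : scales Y) (f : X -> Y) : Prop :=
  exists n, forall y, exists x, F n (f x) y.

Definition coarse_iso X Y (E : scales X) (F : scales Y) : Prop :=
  exists f : X -> Y, [/\ controlled E F f, expansive E F f & cobounded F f].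

Lemma coarse_iso_sym X Y (E : scales X) (F : scales Y) :
  coarse_scales F -> coarse_iso E F -> coarse_iso F E.
Proof.
case=> _ Fsym _ Fcomp [f [fC fE [k /choice [g fg]]]]; exists g; split.
- move=> n; have [a Fa] := Fcomp k n; have [b Fb] := Fcomp a k.
  have [m Em] := fE b; exists m => y y' yy'; apply: Em.
  by apply: Fb (Fsym _ _ _ (fg y')); apply: Fa yy'.
- move=> n; have [m Fm] := fC n; have [a Fa] := Fcomp k m.
  have [b Fb] := Fcomp a k; exists b => y y' /Fm gg.
  by apply: Fb (fg y'); apply: Fa gg; apply: Fsym.
- by have [m Em] := fE k; exists m => x; exists (f x); exact/Em/fg.
Qed.

Lemma coarse_iso_trans X Y Z (E : scales X) (F : scales Y) (H : scales Z) :
  coarse_scales H -> coarse_iso E F -> coarse_iso F H -> coarse_iso E H.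
Proof.
case=> _ _ _ Hcomp [f [fC fE [k fk]]] [g [gC gE [l gl]]].
exists (g \o f); split.
- move=> n; have [m Fm] := fC n; have [a Ha] := gC m.
  by exists a => x y /Fm /Ha.
- move=> n; have [m Fm] := gE n; have [a Ea] := fE m.
  by exists a => x y /Fm /Ea.
- have [m Hm] := gC k; have [a Ha] := Hcomp m l; exists a => z.
  have [y gyz] := gl z; have [x fxy] := fk y.
  by exists x; apply: Ha gyz; exact: Hm.
Qed.

(** Chains are encoded by induction: [y] belongs to every set that contains [x] and is stable under
    steps of scale [n]. For groups, this coarse invariant detects finite generation. *)
Definition chain_connected X (E : scales X) : Prop :=
  exists n, forall x y (P : X -> Prop),
    P x -> (forall u v, P u -> E n u v -> P v) -> P y.

Lemma chain_connected_iso X Y (E : scales X) (F : scales Y) :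
  coarse_scales F -> coarse_iso E F -> chain_connected E -> chain_connected F.
Proof.
case=> _ Fsym Fmono _ [f [fC _ [k fk]]] [n En]; have [m Fm] := fC n.
exists (maxn m k) => y y' P Py Pstep.
have [x xy] := fk y; have [x' xy'] := fk y'.
apply: (Pstep (f x')); last by apply: Fmono xy'; exact: leq_maxr.
apply: (En x x' (P \o f)) => [|u v Pu /Fm uv] /=.
  by apply: (Pstep y) => //; apply/Fsym; apply: Fmono xy; exact: leq_maxr.
by apply: Pstep Pu _; apply: Fmono uv; exact: leq_maxl.
Qed.

(** Asymptotic dimension without covers: [c x] selects one of the families, and [p x], a point near
    [x], labels the piece of that family to which [x] belongs. *)
Definition coarse_dim_le X (E : scales X) (k : nat) : Prop :=
  forall n, exists m (c : X -> 'I_k.+1) (p : X -> X),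
    (forall x, E m x (p x)) /\
    (forall x y, c x = c y -> E n x y -> p x = p y).

Lemma coarse_dim_leW X (E : scales X) (k l : nat) :
  (k <= l)%N -> coarse_dim_le E k -> coarse_dim_le E l.
Proof.
rewrite -ltnS => kl dimE n; have [m [c [p [pm pc]]]] := dimE n.
exists m, (widen_ord kl \o c), p; split => // x y [cxy].
by apply: pc; exact: val_inj.
Qed.

(** One point is chosen in each fibre; the [option] accounts for the empty fibres. *)
Lemma fiber_section X Z (h : X -> Z) :
  exists s : X -> X, (forall x, h (s x) = h x) /\
                     (forall x y, h x = h y -> s x = s y).
Proof.
have /choice [q qP] : forall z, exists o : option X,
    forall x, h x = z -> exists2 x', o = Some x' & h x' = z.
  move=> z; have [[x0 hx0]|no] := pselect (exists x, h x = z).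
    by exists (Some x0) => x _; exists x0.
  by exists None => x hx; case: no; exists x.
exists (fun x => odflt x (q (h x))); split=> [x|x y hxy].
  by have [x' -> ] := qP (h x) x erefl.
by rewrite hxy; have [x' -> ] := qP (h y) y erefl.
Qed.

(** The pulled back labels [p \o f] lie in [Y]. They are replaced by a point [s x] of their fibre:
    [f x] and [f (s x)] are both near the common label, so [x] and [s x] are close by
    expansiveness. *)
Lemma coarse_dim_le_embed X Y (E : scales X) (F : scales Y) (f : X -> Y) k :
  coarse_scales F -> controlled E F f -> expansive E F f ->
  coarse_dim_le F k -> coarse_dim_le E k.
Proof.
case=> _ Fsym _ Fcomp fC fE dimF n.
have [n' Fn'] := fC n; have [m [c [p [pm pc]]]] := dimF n'.
have [a Fa] := Fcomp m m; have [b Eb] := fE a.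
have [s [sp sc]] := fiber_section (p \o f).
exists b, (c \o f), s; split=> [x|x y /= cxy /Fn' /(pc _ _ cxy) /sc //].
by apply/Eb/(Fa _ _ _ (pm _)); rewrite -[p (f x)]sp; exact/Fsym.
Qed.

Lemma coarse_dim_le_iso X Y (E : scales X) (F : scales Y) k :
  coarse_scales E -> coarse_scales F -> coarse_iso E F ->
  coarse_dim_le E k <-> coarse_dim_le F k.
Proof.
move=> cE cF EF; split.
  by have [f [fC fE _]] := coarse_iso_sym cF EF; exact: coarse_dim_le_embed fE.
by have [f [fC fE _]] := EF; exact: coarse_dim_le_embed fE.
Qed.

Definition prod_scales X Y (E : scales X) (F : scales Y) : scales (X * Y) :=
  fun n u v => E n u.1 v.1 /\ F n u.2 v.2.

Lemma coarse_prod_scales X Y (E : scales X) (F : scales Y) :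
  coarse_scales E -> coarse_scales F -> coarse_scales (prod_scales E F).
Proof.
move=> [Er Es Em Ec] [Fr Fs Fm Fc]; split=> [n x|n x y|m n x y mn|m n].
- by split.
- by case=> /Es xy1 /Fs xy2; split.
- by case=> xy1 xy2; split; [exact: Em xy1 | exact: Fm xy2].
- have [[a Ea] [b Fb]] := (Ec m n, Fc m n); exists (maxn a b) => x y z.
  move=> [xy1 xy2] [yz1 yz2]; split.
    by apply: Em (Ea _ _ _ xy1 yz1); exact: leq_maxl.
  by apply: Fm (Fb _ _ _ xy2 yz2); exact: leq_maxr.
Qed.

Lemma coarse_iso_prodr X Y Z (E : scales X) (F : scales Y) (H : scales Z) :
  coarse_scales E -> coarse_scales F -> coarse_scales H -> coarse_iso F H ->
  coarse_iso (prod_scales E F) (prod_scales E H).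
Proof.
move=> [Er Es Em _] [_ _ Fm _] [_ _ Hm _] [f [fC fE [k fB]]].
exists (fun u => (u.1, f u.2)); split=> [n|n|].
- have [m fm] := fC n; exists (maxn n m) => x y [xy1 /fm xy2]; split.
    by apply: Em xy1; exact: leq_maxl.
  by apply: Hm xy2; exact: leq_maxr.
- have [m fm] := fE n; exists (maxn n m) => x y [xy1 /fm xy2]; split.
    by apply: Em xy1; exact: leq_maxl.
  by apply: Fm xy2; exact: leq_maxr.
- by exists k => -[x z]; have [y fyz] := fB z; exists (x, y).
Qed.

(** Since [F n] is an equivalence relation, its classes are bounded and distinct classes are never
    close at scale [n]. They refine the pieces without any new colour. *)
Lemma coarse_dim_le_prod X Y (E : scales X) (F : scales Y) k :
  coarse_scales E -> coarse_scales F ->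
  (forall n x y z, F n x y -> F n y z -> F n x z) ->
  coarse_dim_le E k -> coarse_dim_le (prod_scales E F) k.
Proof.
move=> [_ _ Emono _] [Frefl Fsym Fmono _] Ftrans dimE n.
have [m [c [p [pm pc]]]] := dimE n.
have [s [sF sc]] := fiber_section (F n).
exists (maxn m n), (c \o fst), (fun u => (p u.1, s u.2)); split.
  move=> u; split=> /=; first by apply: Emono (pm _); exact: leq_maxl.
  apply: Fmono (leq_maxr _ _) _; apply: Fsym.
  by rewrite sF; exact: Frefl.
move=> u v /= cuv [Euv Fuv]; congr (_, _); first exact: pc.
apply: sc; apply/funext => z; apply/propext.
by split; apply: Ftrans => //; exact: Fsym.
Qed.

(** * The coarse dimension of the integer lattice *)

Definition zscales r : scales {ffun 'I_r -> int} :=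
  fun n x y => forall l, `|x l - y l| <= n%:Z.

Lemma coarse_zscales r : coarse_scales (@zscales r).
Proof.
split=> [n x l|n x y xy l|m n x y mn xy l|m n].
- by rewrite subrr.
- by rewrite distrC.
- by have := xy l; lia.
- by exists (m + n)%N => x y z xy yz l; have := xy l; have := yz l; lia.
Qed.

Lemma zscales_dim_gt n : ~ coarse_dim_le (@zscales n.+1) n.
Proof.
move=> /(_ 1) [m [c [p [pm pc]]]].
apply: (@no_degenerate_labelling n m c p) => [x l|//].
by rewrite distrC; exact: pm.
Qed.

(* With P = (r + 1) d, the bricks of colour i are the intervals
   [(i + 1) d + P k, i d + P (k + 1)), and the complementary gaps of distinct
   colours are disjoint. Hence r coordinates leave at least one colour i such
   that all of them lie in bricks of colour i. *)
Definition brick (r : nat) (d : int) (i : 'I_r.+1) (x : int) : int :=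
  ((x - (i%:Z + 1) * d) %/ (r.+1%:Z * d))%Z.

(** For [d > 0], the gaps of all colours are the intervals [j d, (j + 1) d), of colour [j] modulo
    [r + 1]. This is the only colour for which [x] lies in a gap. *)
Definition gap_colour (r : nat) (d : int) (x : int) : 'I_r.+1 :=
  inord `|((x %/ d)%Z %% r.+1%:Z)%Z|%N.

Lemma brick_le r d (i : 'I_r.+1) x : 0 < d ->
  brick d i x * (r.+1%:Z * d) <= x - (i%:Z + 1) * d.
Proof. by move=> d0; apply: lez_floor; rewrite mulf_neq0 // gt_eqF. Qed.

Lemma brick_gt r d (i : 'I_r.+1) x : 0 < d -> gap_colour r d x != i ->
  x + d < (brick d i x + 1) * (r.+1%:Z * d) + (i%:Z + 1) * d.
Proof.
move=> d0; rewrite /brick; set P := r.+1%:Z * d; set k := (_ %/ _)%Z.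
have P0 : 0 < P by rewrite mulr_gt0.
have kgt : x - (i%:Z + 1) * d < (k + 1) * P by exact: ltz_ceil.
rewrite ltNge; apply: contra => kle.
have xE : x = ((k + 1) * r.+1%:Z + i%:Z) * d + (x - (k + 1) * P - i%:Z * d).
  by rewrite /P; ring.
have {}xE : (x %/ d)%Z = (k + 1) * r.+1%:Z + i%:Z.
  rewrite {1}xE divzMDl ?gt_eqF // divz_small ?addr0 //.
  by lia.
rewrite /gap_colour xE modzMDl modz_small; last by have := ltn_ord i; lia.
by rewrite absz_nat inord_val.
Qed.

Lemma brick_eq r d (i : 'I_r.+1) x y : gap_colour r d x != i ->
  gap_colour r d y != i -> `|x - y| < d -> brick d i x = brick d i y.
Proof.
move=> xi yi xy; have d0 : 0 < d by lia.
have le (u v : int) : u < v -> (u + 1) * (r.+1%:Z * d) <= v * (r.+1%:Z * d).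
  by move=> uv; rewrite ler_wpM2r //; [rewrite mulr_ge0 //; lia | lia].
have := brick_le i x d0; have := brick_gt d0 xi.
have := brick_le i y d0; have := brick_gt d0 yi.
move: (brick d i x) (brick d i y) => u v.
case: (ltgtP u v) => [/le||//]; first lia.
by move/le; lia.
Qed.

Lemma zscales_dim_le r : coarse_dim_le (@zscales r) r.
Proof.
move=> n; pose d : int := n.+1; pose P : int := r.+1%:Z * d.
have d0 : 0 < d by [].
have free (x : {ffun 'I_r -> int}) :
    exists i : 'I_r.+1, forall l, gap_colour r d (x l) != i.
  apply: contrapT => /forallNP none.
  have /choice [g gP] : forall i : 'I_r.+1, exists l, gap_colour r d (x l) = i.
    by move=> i; have /existsNP [l /negP/negPn/eqP ] := none i; exists l.
  have /leq_card : injective g by move=> i j gij; rewrite -(gP i) gij gP.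
  by rewrite !card_ord ltnn.
have [c cP] := choice free.
(* If [x l] lies in brick [k] of colour [i], then [x l - k P] is between [(i + 1) d] and [P + i d],
   and [i d < P]. *)
exists (2 * `|P|)%N, c, (fun x => [ffun l => brick d (c x) (x l) * P]); split.
  move=> x l; rewrite ffunE.
  have := brick_le (c x) (x l) d0; have := brick_gt d0 (cP x l).
  have : (c x)%:Z * d <= r%:Z * d by rewrite ler_wpM2r // lez_nat -ltnS.
  have : 0 <= (c x)%:Z * d by rewrite mulr_ge0.
  have : P = r%:Z * d + d by rewrite /P -addn1 PoszD; ring.
  rewrite -/P; lia.
move=> x y cxy xy; apply/ffunP => l; rewrite !ffunE cxy; congr (_ * _).
by apply: brick_eq; rewrite -?cxy //; [rewrite cxy | have := xy l; rewrite /d; lia].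
Qed.

(** * Coarse equivalence of homogeneous trees *)

Local Open Scope nat_scope.


Definition block_scales (A : nat -> nat) : scales nat :=
  fun n x y => x %/ A n = y %/ A n.

Definition divisor_chain (A : nat -> nat) : Prop :=
  forall n, 0 < A n /\ A n %| A n.+1.

Definition unbounded (A : nat -> nat) : Prop := forall N, exists n, N < A n.

Lemma divisor_chain_dvd A m n : divisor_chain A -> m <= n -> A m %| A n.
Proof.
move=> cA /subnKC <-; elim: (n - m) => [|k IHk]; first by rewrite addn0.
by rewrite addnS; apply: dvdn_trans IHk _; case: (cA (m + k)).
Qed.

Lemma divn_eq_dvd a b x y : a %| b -> x %/ a = y %/ a -> x %/ b = y %/ b.
Proof. by case/dvdnP=> q ->; rewrite mulnC !divnMA => ->. Qed.

Lemma block_scales_trans A n x y z :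
  block_scales A n x y -> block_scales A n y z -> block_scales A n x z.
Proof. by rewrite /block_scales => ->. Qed.

Lemma coarse_block_scales A : divisor_chain A -> coarse_scales (block_scales A).
Proof.
move=> cA.
have mono m n x y : m <= n -> block_scales A m x y -> block_scales A n x y.
  by move=> mn; apply: divn_eq_dvd; exact: divisor_chain_dvd.
split=> // m n; exists (maxn m n) => x y z xy yz.
apply: (@block_scales_trans _ _ _ y); first exact: mono (leq_maxl _ _) xy.
exact: mono (leq_maxr _ _) yz.
Qed.

Lemma block_scales_subseq A (k : nat -> nat) : divisor_chain A ->
  (forall n, n <= k n) -> coarse_iso (block_scales (A \o k)) (block_scales A).
Proof.
move=> cA nk; exists id; split=> [n|n|]; first by exists (k n).
  by exists n => x y; apply: divn_eq_dvd; exact: divisor_chain_dvd.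
by exists 0 => y; exists y.
Qed.

(* A block of size [a] is cut into [s] consecutive pieces, the first [u] of
   size [mu] and the others of size [mu + 1]; here is the start of piece [k]. *)
Definition piece_start (mu u k : nat) : nat := k * mu + (k - u).

(** Block [k] of size [B] is matched with piece [k], made of [mu] or [mu + 1] blocks of size [A],
    through [R false] or [R true] respectively. The arguments are swapped, as the two trees exchange
    roles at each level. *)
Definition concat_rel (A B mu u s : nat) (R : bool -> nat -> nat -> Prop)
    (y x : nat) : Prop :=
  exists k x0 y0, [/\ k < s, R (u <= k) x0 y0,
    y = k * B + y0 & x = piece_start mu u k * A + x0].

Definition flip_rel (b : bool) (R : nat -> nat -> Prop) x y :=
  if b then R y x else R x y.

(** The analogue for relations of a controlled map between the two trees, whose block sizes are the
    terms of [c] of even and of odd index. *)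
Definition level_map (c : nat -> nat) (i : nat) (S : nat -> nat -> Prop) :=
  forall u v u' v', S u v -> S u' v' ->
    u %/ c i = u' %/ c i -> v %/ c i.+1 = v' %/ c i.+1.

(** A matching of [m] blocks of size [c t] with one block of size [c t.+1]. Blocks of size [c i]
    subdivide the first side if [t + i] is even and the second side otherwise, whence the flip. *)
Definition shape (c : nat -> nat) (t m : nat) (R : nat -> nat -> Prop) : Prop :=
  [/\ forall x y, R x y -> x < m * c t /\ y < c t.+1,
      forall x, x < m * c t -> exists y, R x y,
      forall y, y < c t.+1 -> exists x, R x y &
      forall i, i <= t -> level_map c i (flip_rel (odd (t + i)) R)].

Definition interleaved_chains (c : nat -> nat) : Prop :=
  forall t, 0 < c t /\ c t %| c t.+2.

Lemma interleaved_dvd c i t : interleaved_chains c -> i <= t ->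
  ~~ odd (t + i) -> c i %| c t.
Proof.
move=> cc /subnKC <-; rewrite addnAC addnn oddD odd_double /=.
move: (t - i) => d evd; rewrite -[d]odd_double_half (negPf evd) add0n.
elim: d./2 => [|k IHk]; first by rewrite addn0.
by rewrite doubleS !addnS; apply: dvdn_trans IHk _; case: (cc (i + k.*2)).
Qed.

Lemma piece_startS mu u k :
  piece_start mu u k.+1 = piece_start mu u k + (mu + (u <= k)).
Proof. by rewrite /piece_start; case: leqP => /=; lia. Qed.

Lemma piece_start_homo mu u k k' : k <= k' ->
  piece_start mu u k <= piece_start mu u k'.
Proof.
move/subnKC <-; elim: (k' - k) => [|d IHd]; first by rewrite addn0.
by rewrite addnS piece_startS; lia.
Qed.

Lemma piece_inj mu u A k k' x x' : 0 < A ->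
  x < (mu + (u <= k)) * A -> x' < (mu + (u <= k')) * A ->
  (piece_start mu u k * A + x) %/ A = (piece_start mu u k' * A + x') %/ A ->
  k = k'.
Proof.
move=> A0; wlog kk' : k k' x x' / k <= k' => [H|] xk xk' E.
  by case/orP: (leq_total k k') => h; [|apply/esym]; apply: H h _ _ _; eauto.
move: E; rewrite !divnMDl // => E.
have : x %/ A < mu + (u <= k) by rewrite ltn_divLR.
case: (ltngtP k k') kk' => // kk' _.
have := @piece_start_homo mu u k.+1 k' kk'; rewrite piece_startS.
move: (piece_start _ _ _) (piece_start _ _ _) (x %/ A) (x' %/ A) E; lia.
Qed.

Lemma divn_offset a A p x : 0 < a -> a %| A ->
  (p * A + x) %/ a = p * (A %/ a) + x %/ a.
Proof. by move=> a0 /dvdnP[q ->]; rewrite mulnK // mulnA divnMDl. Qed.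

(** With [a = c t.+2 %/ c t], the inequalities say that [a] is a sum of [s] terms, of which
    [s * mu.+1 - a] equal [mu] and the others [mu.+1]. A block of size [c t.+2] is cut accordingly
    into pieces, each matched with a block of size [c t.+1]. *)
Lemma shape_concat c t mu s (R : bool -> nat -> nat -> Prop) :
  interleaved_chains c -> (forall b : bool, shape c t (mu + b) (R b)) ->
  s * mu <= c t.+2 %/ c t < s * mu.+1 ->
  shape c t.+1 s
    (concat_rel (c t) (c t.+1) mu (s * mu.+1 - c t.+2 %/ c t) s R).
Proof.
move=> cc shR; set a := c t.+2 %/ c t => /andP[sa as1].
set u := s * mu.+1 - a; have u0 : 0 < u by rewrite /u; lia.
have [ct0 ctd] := cc t; have [ct10 _] := cc t.+1.
have aE : c t.+2 = a * c t by rewrite divnK.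
have ps : piece_start mu u s = a by rewrite /piece_start /u; nia.
split.
- move=> y x [k [x0 [y0 [ks Rxy -> ->]]]]; have [dR _ _ _] := shR (u <= k).
  have [x0lt y0lt] := dR _ _ Rxy; split.
    by apply: (@leq_trans (k.+1 * c t.+1)); rewrite ?leq_mul2r ?ks ?orbT //; lia.
  rewrite aE -ps; apply: (@leq_trans (piece_start mu u k.+1 * c t)).
    by rewrite piece_startS mulnDl; lia.
  by rewrite leq_mul2r piece_start_homo ?orbT.
- move=> y ylt; have ks : y %/ c t.+1 < s by rewrite ltn_divLR.
  have [_ _ sR _] := shR (u <= y %/ c t.+1).
  have [x0 Rx0] := sR _ (ltn_pmod y ct10).
  exists (piece_start mu u (y %/ c t.+1) * c t + x0).
  by exists (y %/ c t.+1), x0, (y %% c t.+1); split; rewrite -?divn_eq.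
- move=> x; rewrite aE -ps => xlt.
  have exk : exists k, x < piece_start mu u k * c t by exists s.
  case: (ex_minnP exk) => -[|k] xk kmin; first by rewrite /piece_start in xk.
  have ks : k < s by exact: kmin.
  have kx : piece_start mu u k * c t <= x.
    by rewrite leqNgt; apply/negP => /kmin; rewrite ltnn.
  have [_ tR _ _] := shR (u <= k).
  have [|y0 Ry0] := tR (x - piece_start mu u k * c t).
    by move: xk; rewrite piece_startS mulnDl; lia.
  exists (k * c t.+1 + y0), k, (x - piece_start mu u k * c t), y0.
  by split=> //; rewrite subnKC.
- move=> i; rewrite leq_eqVlt => /orP[/eqP ->|].
    (* At the top level [i = t.+1], the whole target is a single block of size [c t.+2]. *)
    rewrite addnn odd_double => y x y' x' /= [k [x0 [y0 [ks Rxy _ ->]]]].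
    move=> [k' [x0' [y0' [ks' Rxy' _ ->]]]] _.
    have small l (z w : nat) : l < s -> R (u <= l) z w ->
        piece_start mu u l * c t + z < c t.+2.
      move=> ls Rzw; have [dR _ _ _] := shR (u <= l); have [zlt _] := dR _ _ Rzw.
      rewrite aE -ps; apply: (@leq_trans (piece_start mu u l.+1 * c t)).
        by rewrite piece_startS mulnDl; lia.
      by rewrite leq_mul2r piece_start_homo ?orbT.
    by rewrite !divn_small //; apply: small; eauto.
  rewrite ltnS => it; rewrite addSn /=.
  have shL k := let: And4 _ _ _ L := shR (u <= k) in L i it.
  (* In both cases, points in one block of size [c i] have the same piece number [k]: they share a
     block of size [c t.+1] in the first case, and a block of size [c t] in the second. The claim
     then reduces to the shape of that piece. *)
  case ti : (odd (t + i)) shL => /= shL.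
    move=> y x y' x' [k [x0 [y0 [ks Rxy -> ->]]]].
    move=> [k' [x0' [y0' [ks' Rxy' -> ->]]]] E.
    have ci1 : c i %| c t.+1.
      by apply: interleaved_dvd; rewrite ?addSn /= ?ti // leqW.
    have i1t : i.+1 <= t.
      by move: it ti; rewrite leq_eqVlt => /orP[/eqP->|//]; rewrite addnn odd_double.
    have ci2 : c i.+1 %| c t by apply: interleaved_dvd; rewrite ?addnS /= ?ti.
    have [dR _ _ _] := shR (u <= k); have [_ y0lt] := dR _ _ Rxy.
    have [dR' _ _ _] := shR (u <= k'); have [_ y0lt'] := dR' _ _ Rxy'.
    have kk' : k = k'.
      have := divn_eq_dvd ci1 E.
      by rewrite !divnMDl // !(@divn_small _ (c t.+1)) // !addn0.
    rewrite -{k'}kk' in ks' Rxy' E dR' *.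
    rewrite !divn_offset //; try by case: (cc i.+1).
    congr (_ + _); apply: (shL k _ _ _ _ Rxy Rxy').
    by move: E; rewrite !divn_offset //; [move/addnI | case: (cc i)..].
  move=> x y x' y' /= [k [x0 [y0 [ks Rxy -> ->]]]].
  move=> [k' [x0' [y0' [ks' Rxy' -> ->]]]] E.
  have ci1 : c i %| c t by apply: interleaved_dvd; rewrite ?ti.
  have ci2 : c i.+1 %| c t.+1.
    by apply: interleaved_dvd; rewrite ?ltnS // addSn addnS /= ti.
  have [dR _ _ _] := shR (u <= k); have [x0lt _] := dR _ _ Rxy.
  have [dR' _ _ _] := shR (u <= k'); have [x0lt' _] := dR' _ _ Rxy'.
  have kk' : k = k' by apply: piece_inj x0lt x0lt' (divn_eq_dvd ci1 E).
  rewrite -{k'}kk' in ks' Rxy' E dR' x0lt' *.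
  rewrite !divn_offset //; try by case: (cc i.+1).
  congr (_ + _); apply: (shL k _ _ _ _ Rxy Rxy').
  by move: E; rewrite !divn_offset //; [move/addnI | case: (cc i)..].
Qed.

(** The Boolean chooses between [mu t] and [mu t + 1] blocks, the two kinds of pieces needed at the
    next level. At level 0 all points are related. *)
Fixpoint tower_rel (c mu : nat -> nat) (t : nat) (b : bool) : nat -> nat -> Prop :=
  if t is t'.+1 then
    let s := mu t'.+1 + b in
    concat_rel (c t') (c t'.+1) (mu t')
      (s * (mu t').+1 - c t'.+2 %/ c t') s (tower_rel c mu t')
  else fun x y => x < (mu 0 + b) * c 0 /\ y < c 1.

Definition growing_chains (c mu : nat -> nat) : Prop :=
  [/\ interleaved_chains c, 0 < mu 0 & forall t,
    2 * mu t * (mu t).+1 <= c t.+2 %/ c t /\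
    mu t.+1 = (c t.+2 %/ c t) %/ mu t - 1].

(** Write [a] for the ratio, [m] for [mu t] and [q] for the quotient of [a] by [m], so that
    [q >= 2 * (m + 1)]. Both [s = q - 1] and [s = q] are suitable, since
    [(q - 1) * (m + 1) >= q * m + m + 1 > a]. *)
Lemma growing_mu c mu t : growing_chains c mu -> 0 < mu t /\
  forall b : bool, (mu t.+1 + b) * mu t <= c t.+2 %/ c t
                   < (mu t.+1 + b) * (mu t).+1.
Proof.
case=> _ mu0 gr.
have step s : 0 < mu s -> 0 < mu s.+1 /\
    forall b : bool, (mu s.+1 + b) * mu s <= c s.+2 %/ c s
                     < (mu s.+1 + b) * (mu s).+1.
  move=> ms; have [le ->] := gr s; set a := c s.+2 %/ c s in le *.
  have := divn_eq a (mu s); have := ltn_pmod a ms.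
  move: (a %/ mu s) (a %% mu s) => q r rlt aE.
  have qm : 2 * (mu s).+1 <= q by rewrite leqNgt; apply/negP => ?; nia.
  by split=> [|b]; [lia | rewrite aE; case: b => /=; nia].
have pos : 0 < mu t by elim: t => // t /step [].
by split=> //; have [] := step _ pos.
Qed.

Lemma shape_tower c mu t (b : bool) : growing_chains c mu ->
  shape c t (mu t + b) (tower_rel c mu t b).
Proof.
move=> gr; have [cc _ _] := gr.
elim: t b => [|t IHt] b; last first.
  by apply: shape_concat => //; have [_ ->] := growing_mu t gr.
have c1 : 0 < c 1 by case: (cc 1).
have m0 : 0 < (mu 0 + b) * c 0.
  by rewrite muln_gt0 addn_gt0; have [-> _] := growing_mu 0 gr; case: (cc 0).
split=> [//|x xlt|y ylt|i]; [by exists 0 | by exists 0 |].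
rewrite leqn0 => /eqP-> u v u' v' /= [_ vlt] [_ vlt'] _.
by rewrite !divn_small.
Qed.

(** The strict upper bound on the ratio makes the number of pieces with [mu t] blocks positive.
    Hence piece 0 has the shape [false] and starts at 0, so each level extends the previous one. *)
Lemma tower_rel_le c mu s t : growing_chains c mu -> s <= t ->
  forall x y, flip_rel (odd s) (tower_rel c mu s false) x y ->
              flip_rel (odd t) (tower_rel c mu t false) x y.
Proof.
move=> gr /subnKC <-; elim: (t - s) => [|d IHd] x y; first by rewrite addn0.
move/IHd; rewrite addnS; move: {IHd s t}(s + d) => t /=.
have [[mt H] [mt1 _]] := (growing_mu t gr, growing_mu t.+1 gr).
have {H} /andP[_ H] := H false.
have Hu : ((mu t.+1 + false) * (mu t).+1 - c t.+2 %/ c t <= 0) = false.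
  by rewrite leqn0 subn_eq0 leqNgt H.
have s0 : 0 < mu t.+1 + false by rewrite addn0.
by case: (odd t) => /= Rxy; exists 0; [exists y, x | exists x, y]; split;
  rewrite ?Hu.
Qed.

(** The union [S] of all levels is total and surjective, because the initial blocks exhaust the
    natural numbers. It respects blocks in both directions, so any function chosen inside [S] is a
    coarse equivalence. *)
Lemma coarse_iso_growing c mu : growing_chains c mu ->
  coarse_iso (block_scales (fun j => c j.*2)) (block_scales (fun j => c j.*2.+1)).
Proof.
move=> gr; have [cc _ _] := gr.
pose S x y := exists t, flip_rel (odd t) (tower_rel c mu t false) x y.
have levS i : level_map c i (flip_rel (odd i) S).
  move=> u v u' v' Suv Suv'.
  have [t [it tuv tuv']] : exists t, [/\ i <= t,
      flip_rel (odd (t + i)) (tower_rel c mu t false) u v &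
      flip_rel (odd (t + i)) (tower_rel c mu t false) u' v'].
    have lift w z : flip_rel (odd i) S w z -> exists t, forall t', t <= t' ->
        flip_rel (odd (t' + i)) (tower_rel c mu t' false) w z.
      rewrite /flip_rel; case: ifP => oi [t St]; exists t => t' tt';
      have := tower_rel_le gr tt' St;
      by rewrite oddD oi; case: (odd t').
    have [[t1 H1] [t2 H2]] := (lift _ _ Suv, lift _ _ Suv').
    by exists (maxn i (maxn t1 t2)); split; [lia | apply: H1 | apply: H2]; lia.
  have [_ _ _ L] := shape_tower t false gr.
  exact: L tuv tuv'.
have big j : j < c j.*2 /\ j < c j.*2.+1.
  have grow t : (c t).*2 <= c t.+2.
    have [_ _ /(_ t) [le _]] := gr; have [mt _] := growing_mu t gr.
    have [ct0 ctd] := cc t; rewrite -(divnK ctd) -mul2n leq_mul2r.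
    by apply/orP; right; apply: leq_trans le; nia.
  elim: j => [|j [IH1 IH2]]; first by case: (cc 0); case: (cc 1).
  by have := grow j.*2; have := grow j.*2.+1; rewrite doubleS; lia.
have totS x : exists y, S x y.
  have [_ tot _ _] := shape_tower x.*2 false gr; have [xlt _] := big x.
  have [m0 _] := growing_mu x.*2 gr.
  have [|y Rxy] := tot x; last by exists y, x.*2; rewrite odd_double.
  by rewrite addn0; apply: leq_trans xlt (leq_pmull _ _).
have surS y : exists x, S x y.
  have [_ _ sur _] := shape_tower y.*2 false gr; have [_ ylt] := big y.
  by have [x Rxy] := sur y ylt; exists x, y.*2; rewrite odd_double.
have [f fS] := choice totS; exists f; split.
- move=> n; exists n => x x' E; move: (levS n.*2); rewrite odd_double => L.
  exact: L (fS x) (fS x') E.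
- move=> n; exists n.+1 => x x' E.
  by move: (levS n.*2.+1); rewrite /= odd_double => L; exact: L (fS x) (fS x') E.
- exists 0 => y; have [x Sxy] := surS y; exists x.
  by apply: (levS 0 _ _ _ _ (fS x) Sxy).
Qed.

Lemma coarse_iso_blocks A B : divisor_chain A -> divisor_chain B ->
  unbounded A -> unbounded B -> coarse_iso (block_scales A) (block_scales B).
Proof.
move=> cA cB uA uB.
pose Ch b := if b then B else A.
have cCh b : divisor_chain (Ch b) by case: b.
(* The entries are the chain, the current index and a lower bound for the ratio of the next term to
   the current one. *)
have /choice [next nextP] : forall z : bool * nat * nat, exists i,
    z.1.2 < i /\ z.2 <= Ch z.1.1 i %/ Ch z.1.1 z.1.2.
  move=> [[b i] M] /=; have uCh : unbounded (Ch b) by case: b.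
  have [j jP] := uCh (M * Ch b i); have [Ci0 _] := cCh b i.
  exists (maxn i.+1 j); split; first exact: leq_maxl.
  rewrite leq_divRL //; apply: leq_trans (ltnW jP) _.
  apply: dvdn_leq; first by case: (cCh b (maxn i.+1 j)).
  by apply: divisor_chain_dvd => //; exact: leq_maxr.
(* A state (i, j, mu) records that c t and c (t + 1) have indices i and j. *)
pose upd b z : nat * nat * nat := let: (i, j, mu) := z in
  let i' := next (b, i, 2 * mu * mu.+1) in (j, i', (Ch b i' %/ Ch b i) %/ mu - 1).
pose st := fix st t := if t is t'.+1 then upd (odd t') (st t') else (0, 0, 1).
pose k t := (st t).1.1; pose mu t := (st t).2; pose c t := Ch (odd t) (k t).
have kS t : (st t).1.2 = k t.+1.
  by rewrite /k /= /upd; case: (st t) => [[i j] m].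
have kSS t : k t.+2 = next (odd t, k t, 2 * mu t * (mu t).+1).
  by rewrite -kS /= /mu /k; case: (st t) => [[i j] m].
have muS t : mu t.+1 = (c t.+2 %/ c t) %/ mu t - 1.
  rewrite /c kSS /= negbK /mu /k /=; case: (st t) => [[i j] m] //=.
have klt t : k t < k t.+2.
  by rewrite kSS; have [] := nextP (odd t, k t, 2 * mu t * (mu t).+1).
have gr : growing_chains c mu.
  split=> // [t|t].
    rewrite /c /= negbK; have [pos _] := cCh (odd t) (k t); split=> //.
    by apply: divisor_chain_dvd => //; exact: ltnW.
  split; last exact: muS.
  rewrite /c /= negbK kSS.
  by have [] := nextP (odd t, k t, 2 * mu t * (mu t).+1).
have k2 t : t <= k t.*2 /\ t <= k t.*2.+1.
  elim: t => // t [IH1 IH2].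
  by rewrite doubleS; split; apply: leq_ltn_trans (klt _).
have isoA : coarse_iso (block_scales (fun j => c j.*2)) (block_scales A).
  have -> : (fun j => c j.*2) = A \o (fun j => k j.*2).
    by apply/funext => j; rewrite /c odd_double.
  by apply: block_scales_subseq => // j; case: (k2 j).
have isoB : coarse_iso (block_scales (fun j => c j.*2.+1)) (block_scales B).
  have -> : (fun j => c j.*2.+1) = B \o (fun j => k j.*2.+1).
    by apply/funext => j; rewrite /c /= odd_double.
  by apply: block_scales_subseq => // j; case: (k2 j).
have csA := coarse_block_scales cA; have csB := coarse_block_scales cB.
apply: (coarse_iso_trans csB (coarse_iso_sym csA isoA)).
exact: coarse_iso_trans csB (coarse_iso_growing gr) isoB.
Qed.

Local Open Scope ring_scope.

(** * Coordinates on a tower of subgroups *)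

Local Open Scope group_scope.


(** * Subgroups and their generation *)

Lemma subgroupP (G : groupType) (K : set G) :
  subgroup K <-> K 1 /\ forall x y, K x -> K y -> K (x / y).
Proof.
split=> [[K1 KB]|[K1 KB]]; split.
- by move: K1; rewrite inE.
- by move=> x y Kx Ky; have := KB x y; rewrite !inE; apply.
- by rewrite inE.
- by move=> x y; rewrite !inE; exact: KB.
Qed.

Lemma subgroup1 (G : groupType) (K : set G) : subgroup K -> K 1.
Proof. by case/subgroupP. Qed.

Lemma subgroupV (G : groupType) (K : set G) x : subgroup K -> K x -> K x^-1.
Proof. by case/subgroupP=> K1 KB Kx; rewrite -div1g; exact: KB. Qed.

Lemma subgroupM (G : groupType) (K : set G) x y :
  subgroup K -> K x -> K y -> K (x * y).
Proof.
move=> sK Kx Ky; have [_ KB] := (subgroupP K).1 sK.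
by rewrite -[y]invgK; apply: KB => //; exact: subgroupV.
Qed.

Lemma subgroupX (G : groupType) (K : set G) x n :
  subgroup K -> K x -> K (x ^+ n).
Proof.
move=> sK Kx; elim: n => [|n IHn]; first by rewrite expg0; exact: subgroup1.
by rewrite expgS; exact: subgroupM.
Qed.

Lemma subgroup_generated (G : groupType) (S : set G) :
  subgroup (generated_subgroup S).
Proof.
apply/subgroupP; split=> [A [/subgroup1 //]|x y Gx Gy A [sA SA]].
by have [_] := (subgroupP A).1 sA; apply; [exact: Gx | exact: Gy].
Qed.

Lemma generated_min (G : groupType) (S K : set G) :
  subgroup K -> S `<=` K -> generated_subgroup S `<=` K.
Proof. by move=> sK SK x; apply. Qed.

Lemma sub_generated (G : groupType) (S : set G) : S `<=` generated_subgroup S.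
Proof. by move=> x Sx A [_]; apply. Qed.

Definition fg_subgroup (G : groupType) (K : set G) : Prop :=
  subgroup K /\ finitely_generated K.

Definition adjoin (G : groupType) (L : set G) (h : G) : set G :=
  generated_subgroup (L `|` [set h]).

Lemma sub_adjoin (G : groupType) (L : set G) h : L `<=` adjoin L h.
Proof. by move=> x Lx; apply: sub_generated; left. Qed.

Lemma mem_adjoin (G : groupType) (L : set G) h : adjoin L h h.
Proof. by apply: sub_generated; right. Qed.

Lemma adjoin_min (G : groupType) (L K : set G) h :
  subgroup K -> L `<=` K -> K h -> adjoin L h `<=` K.
Proof. by move=> sK LK Kh; apply: generated_min => // x [/LK|->]. Qed.

Lemma fg_adjoin (G : groupType) (L : set G) h :
  fg_subgroup L -> fg_subgroup (adjoin L h).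
Proof.
case=> sL [S finS SL]; split; first exact: subgroup_generated.
exists (S `|` [set h]); first by rewrite finite_setU; split.
rewrite eqEsubset; split.
  apply: generated_min; first exact: subgroup_generated.
  move=> x [Sx|->]; last exact: mem_adjoin.
  by apply: sub_adjoin; rewrite -SL; exact: sub_generated.
apply: adjoin_min; first exact: subgroup_generated.
  rewrite -SL; apply: generated_min; first exact: subgroup_generated.
  by move=> x Sx; apply: sub_generated; left.
by apply: sub_generated; right.
Qed.

Lemma finite_set_bound (T : Type) (F : set T) (P : T -> nat -> Prop) :
  finite_set F -> (forall f m n, (m <= n)%N -> P f m -> P f n) ->
  (forall f, F f -> exists n, P f n) -> exists n, forall f, F f -> P f n.
Proof.
move=> finF mono ex.
have /choice [b bP] : forall f, exists n, F f -> P f n.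
  move=> f; have [/ex [n Pn]|nF] := pselect (F f); last by exists 0%N.
  by exists n.
have := finite_image b finF; move: (b @` F) (@imageP _ _ b F) => B bB finB.
have [n nP] : exists n, forall m, B m -> (m <= n)%N.
  have /finite_seqP [s ->] := finB.
  exists (\max_(i <- s) i)%N => m /= ms; exact: leq_bigmax_seq.
by exists n => f Ff; apply: mono (nP _ (bB _ Ff)) (bP _ Ff).
Qed.

(* [t] enumerates the left cosets of [L] in [K], with digits in [S]. *)
Record coset_step (G : groupType) (L K : set G) (S : set int) (t : int -> G) :
    Prop := CosetStep {
  step0 : S 0%R;
  step1 : t 0%R = 1;
  step_mem : forall s, S s -> K (t s);
  step_cover : forall x, K x -> exists s l, [/\ S s, L l & x = t s * l];
  step_inj : forall s s', S s -> S s' -> L ((t s)^-1 * t s') -> s = s';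
  step_finite : forall B : nat, finite_set [set g | exists s s',
    [/\ S s, S s', (`|s - s'| <= B%:Z)%R & g = (t s)^-1 * t s']];
  step_proper : forall F, finite_set F -> exists B : nat, forall s s' l l',
    S s -> S s' -> L l -> L l' -> F (l * ((t s)^-1 * t s') * l') ->
    (`|s - s'| <= B%:Z)%R }.

Definition finite_classes (G : groupType) (K : set G) : Prop :=
  forall c, K c -> finite_set [set c ^ x | x in K].

Record coset_tower (G : groupType) (K : nat -> set G) (S : nat -> set int)
    (t : nat -> int -> G) : Prop := CosetTower {
  tower0 : K 0%N = [set 1];
  tower_subgroup : forall n, subgroup (K n);
  tower_le : forall n, K n `<=` K n.+1;
  tower_step : forall n, coset_step (K n) (K n.+1) (S n) (t n);
  tower_cover : forall g, exists n, K n g;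
  tower_classes : forall n, finite_classes (K n) }.

Definition finite_coordinates (S : nat -> set int) (x : nat -> int) : Prop :=
  (forall i, S i (x i)) /\ exists n, forall i, (n <= i)%N -> x i = 0%R.

Definition coordinates (S : nat -> set int) : Type :=
  {x : nat -> int | finite_coordinates S x}.

Definition coordinate_scales (S : nat -> set int) : scales (coordinates S) :=
  fun n x y => forall i, ((n <= i)%N -> sval x i = sval y i) /\
                         (`|sval x i - sval y i| <= n%:Z)%R.

(** The higher digits stand on the left, so that equal leading digits of two elements [g] and [h]
    cancel in [g^-1 * h]. *)
Fixpoint coordinate_prod (G : groupType) (t : nat -> int -> G) (x : nat -> int)
    (n : nat) : G :=
  if n is m.+1 then t m (x m) * coordinate_prod t x m else 1.

Lemma tower_le_mono (G : groupType) K S (t : nat -> int -> G) m n :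
  coset_tower K S t -> (m <= n)%N -> K m `<=` K n.
Proof.
move=> tow /subnKC <-; elim: (n - m)%N => [|k IHk]; first by rewrite addn0.
by rewrite addnS; apply: subset_trans IHk _; exact: (tower_le tow).
Qed.

Lemma coordinate_prod_mem (G : groupType) K S (t : nat -> int -> G) x n :
  coset_tower K S t -> (forall i, S i (x i)) -> K n (coordinate_prod t x n).
Proof.
move=> tow Sx; elim: n => [|n IHn] /=; first by rewrite (tower0 tow).
apply: subgroupM; first exact: (tower_subgroup tow).
  by apply: (step_mem (tower_step tow n)).
exact: (tower_le tow).
Qed.

Lemma coordinate_prod_stable (G : groupType) K S (t : nat -> int -> G) x m n :
  coset_tower K S t -> (m <= n)%N -> (forall i, (m <= i)%N -> x i = 0%R) ->
  coordinate_prod t x n = coordinate_prod t x m.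
Proof.
move=> tow /subnKC <- x0; elim: (n - m)%N => [|k IHk]; first by rewrite addn0.
by rewrite addnS /= x0 ?leq_addr // (step1 (tower_step tow _)) mul1g.
Qed.

Lemma coordinate_prod_eq (G : groupType) (t : nat -> int -> G) x y m n :
  (m <= n)%N -> (forall i, (m <= i < n)%N -> x i = y i) ->
  (coordinate_prod t x n)^-1 * coordinate_prod t y n =
  (coordinate_prod t x m)^-1 * coordinate_prod t y m.
Proof.
move=> /subnKC <-; elim: (n - m)%N => [|k IHk] xy; first by rewrite addn0.
rewrite addnS /= xy ?leq_addr ?addnS ?ltnSn // invgM -mulgA mulKg.
by apply: IHk => i /andP[mi ik]; rewrite xy // mi addnS ltnW.
Qed.

Lemma eq_coordinate_prod (G : groupType) (t : nat -> int -> G) x y n :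
  (forall i, (i < n)%N -> x i = y i) ->
  coordinate_prod t x n = coordinate_prod t y n.
Proof.
elim: n => //= n IHn xy.
by rewrite xy // IHn // => i /ltnW; exact: xy.
Qed.

Lemma coordinate_prod_surj (G : groupType) K S (t : nat -> int -> G) n g :
  coset_tower K S t -> K n g ->
  exists x, [/\ forall i, S i (x i), forall i, (n <= i)%N -> x i = 0%R &
                g = coordinate_prod t x n].
Proof.
move=> tow; elim: n g => [|n IHn] g.
  rewrite (tower0 tow) => ->; exists (fun=> 0%R); split=> // i.
  exact: (step0 (tower_step tow _)).
case/(step_cover (tower_step tow n)) => s [l [Ss /IHn [x [Sx x0 ->]] ->]].
exists (fun i => if i == n then s else x i); split=> [i|i ni|].
- by case: eqP => [->|].
- by rewrite gtn_eqF // x0 // ltnW.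
- rewrite /= eqxx; congr (_ * _); apply: eq_coordinate_prod => i.
  by move=> /ltn_eqF ->.
Qed.

Lemma coordinate_prod_inj (G : groupType) K S (t : nat -> int -> G) x y m n :
  coset_tower K S t -> (forall i, S i (x i)) -> (forall i, S i (y i)) ->
  K m ((coordinate_prod t x n)^-1 * coordinate_prod t y n) ->
  forall i, (m <= i < n)%N -> x i = y i.
Proof.
move=> tow Sx Sy; elim: n => [|n IHn] Kxy i; first by rewrite ltn0 andbF.
case: (leqP m n) => [mn|nm]; last by move=> /andP[mi ni]; lia.
have sK := tower_subgroup tow n.
have xyn : x n = y n.
  apply: (step_inj (tower_step tow n)) => //.
  pose u := (coordinate_prod t x n)^-1; pose v := coordinate_prod t y n.
  pose c := (t n (x n))^-1 * t n (y n).
  have Kucv : K n (u * c * v).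
    by have := tower_le_mono tow mn Kxy; rewrite /= invgM !mulgA.
  have Kv : K n v by apply: coordinate_prod_mem tow Sy.
  have Ku : K n u by apply: subgroupV => //; apply: coordinate_prod_mem tow Sx.
  rewrite -/c -[c](mulKg u) -(mulgK v (u * c)) mulgA.
  by apply: subgroupM => //; [apply: subgroupM => // | ]; exact: subgroupV.
case/andP=> mi; rewrite ltnS leq_eqVlt => /orP[/eqP->//|ni].
apply: IHn; rewrite ?mi //.
by move: Kxy; rewrite /= xyn invgM -mulgA mulKg.
Qed.

Lemma finite_conj_by (G : groupType) (K C : set G) : finite_classes K ->
  finite_set C -> C `<=` K -> finite_set [set c ^ x | c in C & x in K].
Proof.
move=> clK finC CK; apply: (@sub_finite_set _ _ (\bigcup_(c in C) [set c ^ x | x in K])).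
  by move=> _ [c Cc [x Kx <-]]; exists c => //; exists x.
by apply: bigcup_finite => // c /CK; exact: clK.
Qed.

(** Let [g], [h] be the products of the first [n] factors and [c] the quotient of the top ones. Then
    the new quotient is [g^-1 * h * c ^ h], where [c] takes finitely many values and has a finite
    conjugacy class. *)
Lemma coordinate_prod_finite (G : groupType) K S (t : nat -> int -> G) n
    (B : nat) : coset_tower K S t ->
  finite_set [set g | exists x y, [/\ forall i, S i (x i), forall i, S i (y i),
    forall i, (i < n)%N -> (`|x i - y i| <= B%:Z)%R &
    g = (coordinate_prod t x n)^-1 * coordinate_prod t y n]].
Proof.
move=> tow; elim: n => [|n IHn].
  apply: (@sub_finite_set _ _ [set 1]) (finite_set1 _) => g.
  by move=> [x [y [_ _ _ ->]]]; rewrite /= invg1 mul1g.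
have step := tower_step tow n.
set F := [set g | _] in IHn; pose C := [set g | exists s s',
    [/\ S n s, S n s', (`|s - s'| <= B%:Z)%R & g = (t n s)^-1 * t n s']].
have finC : finite_set C by exact: step_finite step B.
have CK : C `<=` K n.+1.
  move=> g [s [s' [Ss Ss' _ ->]]]; have sK := tower_subgroup tow n.+1.
  by apply: subgroupM => //; [apply: subgroupV | ] => //; exact: (step_mem step).
have finCK := finite_conj_by (@tower_classes _ _ _ _ tow n.+1) finC CK.
apply: sub_finite_set (finite_image2 (fun u v => u * v) IHn finCK).
move=> g [x [y [Sx Sy xy ->]]] /=.
exists ((coordinate_prod t x n)^-1 * coordinate_prod t y n).
  by exists x, y; split=> // i ni; apply: xy; exact: ltnW.
exists (((t n (x n))^-1 * t n (y n)) ^ coordinate_prod t y n).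
  exists ((t n (x n))^-1 * t n (y n)).
    by exists (x n), (y n); split => //; exact: xy.
  exists (coordinate_prod t y n) => //.
  by apply: (tower_le tow); exact: coordinate_prod_mem tow Sy.
by rewrite conjgE invgM !mulgA mulgK.
Qed.

(** [step_proper] bounds the difference of the top digits. The conjugate of the top quotient then
    lies in a finite set, and dividing by it leaves a quotient of lower products in a finite set
    again. *)
Lemma coordinate_prod_proper (G : groupType) K S (t : nat -> int -> G) n F :
  coset_tower K S t -> finite_set F -> exists B : nat, forall x y,
    (forall i, S i (x i)) -> (forall i, S i (y i)) ->
    F ((coordinate_prod t x n)^-1 * coordinate_prod t y n) ->
    forall i, (i < n)%N -> (`|x i - y i| <= B%:Z)%R.
Proof.
move=> tow; elim: n F => [|n IHn] F finF; first by exists 0%N.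
have step := tower_step tow n; have [B1 HB1] := step_proper step finF.
pose C := [set g | exists s s',
    [/\ S n s, S n s', (`|s - s'| <= B1%:Z)%R & g = (t n s)^-1 * t n s']].
have finC : finite_set C by exact: step_finite step B1.
have CK : C `<=` K n.+1.
  move=> g [s [s' [Ss Ss' _ ->]]]; have sK := tower_subgroup tow n.+1.
  by apply: subgroupM => //; [apply: subgroupV | ] => //; exact: (step_mem step).
have finCK := finite_conj_by (@tower_classes _ _ _ _ tow n.+1) finC CK.
have [B2 HB2] := IHn _ (finite_image2 (fun u v => u / v) finF finCK).
exists (maxn B1 B2) => x y Sx Sy; rewrite /= invgM => Fxy.
have Kx : K n (coordinate_prod t x n)^-1.
  by apply: subgroupV; [exact: (tower_subgroup tow) | exact: coordinate_prod_mem tow Sx].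
have xyn : (`|x n - y n| <= B1%:Z)%R.
  apply: (HB1 _ _ (coordinate_prod t x n)^-1 (coordinate_prod t y n)) => //.
    exact: coordinate_prod_mem tow Sy.
  by move: Fxy; rewrite !mulgA.
move=> i; rewrite ltnS leq_eqVlt => /orP[/eqP->|ni].
  by apply: le_trans xyn _; rewrite lez_nat leq_maxl.
apply: (@le_trans _ _ B2%:Z%R); last by rewrite lez_nat leq_maxr.
apply: HB2 ni => //.
exists ((coordinate_prod t x n)^-1 * (t n (x n))^-1 *
        (t n (y n) * coordinate_prod t y n)) => //.
exists (((t n (x n))^-1 * t n (y n)) ^ coordinate_prod t y n).
  exists ((t n (x n))^-1 * t n (y n)).
    by exists (x n), (y n); split.
  exists (coordinate_prod t y n) => //.
  by apply: (tower_le tow); exact: coordinate_prod_mem tow Sy.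
by rewrite conjgE !invgM !invgK !mulgA !mulgK mulgVK.
Qed.

(** The coarse structure of a proper left-invariant metric on a discrete group: closeness of [x] and
    [y] means that [x^-1 * y] lies in a finite set. *)
Definition proper_scales (G : groupType) (E : scales G) : Prop :=
  (forall F : set G, finite_set F ->
     exists n, forall x y, F (x^-1 * y) -> E n x y) /\
  (forall n, exists2 F : set G, finite_set F &
     forall x y, E n x y -> F (x^-1 * y)).

Lemma coarse_coordinate_scales S : coarse_scales (@coordinate_scales S).
Proof.
split=> [n x i|n x y xy i|m n x y mn xy i|m n].
- by split=> //; rewrite subrr.
- by have [xyi le] := xy i; split=> [/xyi ->//|]; rewrite distrC.
- have [xyi le] := xy i; split=> [ni|]; first by apply: xyi; lia.
  by apply: le_trans le _; rewrite lez_nat.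
- exists (m + n)%N => x y z xy yz i; have [xyi le] := xy i.
  have [yzi le'] := yz i; split=> [mni|]; first by rewrite xyi ?yzi //; lia.
  lia.
Qed.

Lemma coarse_iso_tower (G : groupType) K S (t : nat -> int -> G) (E : scales G) :
  coset_tower K S t -> proper_scales E -> coarse_iso (@coordinate_scales S) E.
Proof.
move=> tow [Efin Eprop].
pose f (x : coordinates S) := coordinate_prod t (sval x) (sval (cid (svalP x).2)).
have Sx (x : coordinates S) : forall i, S i (sval x i) by case: (svalP x).
have fE (x : coordinates S) : exists n, forall m, (n <= m)%N ->
    f x = coordinate_prod t (sval x) m.
  rewrite /f; case: cid => n x0 /=; exists n => m nm.
  by rewrite (coordinate_prod_stable tow nm x0).
have fVf x y n : exists m, [/\ (n <= m)%N,
    (f x)^-1 * f y = (coordinate_prod t (sval x) m)^-1 * coordinate_prod t (sval y) m,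
    forall i, (m <= i)%N -> sval x i = 0%R &
    forall i, (m <= i)%N -> sval y i = 0%R].
  have [[m1 H1] [m2 H2]] := (fE x, fE y).
  have [[m3 H3] [m4 H4]] := ((svalP x).2, (svalP y).2).
  pose m := maxn (maxn n (maxn m1 m2)) (maxn m3 m4).
  exists m; split=> [||i mi|i mi]; [lia | | apply: H3; lia | apply: H4; lia].
  by rewrite (H1 m) ?(H2 m) //; lia.
exists f; split.
- move=> n; have [m Em] := Efin _ (coordinate_prod_finite n n tow).
  exists m => x y xy; apply: Em; exists (sval x), (sval y).
  split; [exact: Sx | exact: Sx | by move=> i _; case: (xy i) |].
  have [k [nk -> _ _]] := fVf x y n.
  by apply: coordinate_prod_eq => // i /andP[ni _]; case: (xy i) => ->.
- move=> n; have [F finF EF] := Eprop n.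
  (* The finite set [F] lies in some [K k]. So the digits from [k] on agree, and properness bounds
     the differences of the others. *)
  have [k Kk] : exists k, forall g, F g -> K k g.
    apply: finite_set_bound => // [g m m' mm'|g _]; last exact: (tower_cover tow).
    exact: (tower_le_mono tow mm').
  have [B HB] := coordinate_prod_proper k tow finF.
  exists (maxn k B) => x y /EF Fxy i; have [m [km fm x0 y0]] := fVf x y k.
  have xyk j : (k <= j)%N -> sval x j = sval y j.
    move=> kj; have [mj|jm] := leqP m j; first by rewrite x0 ?y0.
    apply: (coordinate_prod_inj tow (Sx x) (Sx y) (m := k) (n := m)).
      by rewrite -fm; exact: Kk.
    by rewrite kj.
  split=> [kBi|]; first by apply: xyk; lia.
  have [ki|ik] := leqP k i; first by rewrite xyk // subrr.
  apply: (@le_trans _ _ B%:Z%R); last by rewrite lez_nat leq_maxr.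
  apply: HB ik; [exact: Sx | exact: Sx |].
  have <- : (f x)^-1 * f y = (coordinate_prod t (sval x) k)^-1 *
                             coordinate_prod t (sval y) k.
    by rewrite fm; apply: coordinate_prod_eq => // j /andP[kj _]; exact: xyk.
  exact: Fxy.
- have [n En] := Efin [set 1] (finite_set1 1); exists n => g.
  have [m Kmg] := tower_cover tow g.
  have [x [Sx' x0 ->]] := coordinate_prod_surj tow Kmg.
  have Wx : finite_coordinates S x.
    by split=> //; exists m.
  exists (exist _ x Wx); apply: En; have [k Hk] := fE (exist _ x Wx).
  rewrite (Hk (maxn k m)) ?leq_maxl //=.
  by rewrite (coordinate_prod_stable tow (leq_maxr k m) x0) mulVg.
Qed.

(** * Towers in locally finite-by-abelian groups *)

Definition expgz (G : groupType) (h : G) (z : int) : G :=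
  match z with Posz n => h ^+ n | Negz n => h ^- n.+1 end.

Lemma expgzS (G : groupType) (h : G) z : expgz h (z + 1)%R = expgz h z * h.
Proof.
case: z => [n|[|n]]; first by rewrite -PoszD addn1 /= expgSr.
  by rewrite /= expg1 mulVg.
have -> : (Negz n.+1 + 1 = Negz n)%R by rewrite !NegzE; lia.
by rewrite /= (expgS h n.+1) invgM mulgVK.
Qed.

Lemma expgzD (G : groupType) (h : G) a b :
  expgz h (a + b)%R = expgz h a * expgz h b.
Proof.
elim/int_rect: b => [|n IHn|n IHn]; first by rewrite addr0 mulg1.
  by rewrite -addn1 PoszD addrA !expgzS IHn mulgA.
have S c : expgz h (c - n.+1%:Z)%R = expgz h (c - n%:Z)%R / h.
  have -> : (c - n%:Z = c - n.+1%:Z + 1)%R by lia.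
  by rewrite expgzS mulgK.
by rewrite S IHn -[(- n.+1%:Z)%R]add0r S sub0r mulgA.
Qed.

Lemma expgzN (G : groupType) (h : G) a : expgz h (- a)%R = (expgz h a)^-1.
Proof. by apply/esym/mulg1_eq; rewrite -expgzD subrr. Qed.

Lemma expgzM (G : groupType) (h : G) m a :
  expgz h (a * m%:Z)%R = expgz (h ^+ m) a.
Proof.
elim/int_rect: a => [|n IHn|n IHn]; first by rewrite mul0r.
  by rewrite -addn1 PoszD mulrDl mul1r !expgzD IHn /= expg1.
have -> : (- n.+1%:Z = - n%:Z + -1)%R by lia.
by rewrite mulrDl mulN1r !expgzD IHn !expgzN.
Qed.

Lemma subgroup_expgz (G : groupType) (K : set G) h z :
  subgroup K -> K h -> K (expgz h z).
Proof.
by case: z => n sK Kh /=; [|apply: subgroupV => //]; exact: subgroupX.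
Qed.

Definition finite_index (G : groupType) (L K : set G) : Prop :=
  exists2 T : set G, finite_set T &
    forall x, K x -> exists t l, [/\ T t, L l & x = t * l].

Lemma finite_index_trans (G : groupType) (L M K : set G) :
  finite_index L M -> finite_index M K -> finite_index L K.
Proof.
move=> [T finT TM] [U finU UK].
exists [set u * t | u in U & t in T]; first exact: finite_image2.
move=> x /UK [u [m [Uu /TM [t [l [Tt Ll ->]]] ->]]]; exists (u * t), l.
by split; [exists u => //; exists t | | rewrite mulgA].
Qed.

Lemma finite_index_sub (G : groupType) (L L' K K' : set G) :
  L `<=` L' -> K' `<=` K -> finite_index L K -> finite_index L' K'.
Proof.
move=> LL' KK' [T finT TK]; exists T => // x /KK' /TK [t [l [Tt Ll ->]]].
by exists t, l; split=> //; exact: LL'.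
Qed.

Lemma commutator_mem (G : groupType) (K N : set G) x y :
  normal_subgroup N K -> abelian_quotient K N -> K x -> K y -> N [~ x, y].
Proof.
move=> [sN _ conjN] abN Kx Ky.
have /(congr1 (fun A : set G => A (x * y))) := abN _ _
  (@imageP _ _ (fun z => set_mulg [set z] N) K x Kx)
  (@imageP _ _ (fun z => set_mulg [set z] N) K y Ky).
rewrite propeqE => -[/(_ _) H _].
have : set_mulg (set_mulg [set y] N) (set_mulg [set x] N) (x * y).
  by apply: H; exists x; [exists x => //; exists 1; [exact: subgroup1|rewrite mulg1]
                  | exists y => //; exists y => //; exists 1; [exact: subgroup1|rewrite mulg1]].
case=> _ [_ -> [n Nn <-]] [_ [_ -> [n' Nn' <-]] E].
have -> : [~ x, y] = n ^ x * n'.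
  by rewrite commgEl !conjgE -E -!mulgA mulKg.
by apply: subgroupM => //; exact: conjN.
Qed.

(** A conjugate [c ^ x] is [c * [~ c, x]], with a commutator in the finite subgroup [N]. *)
Lemma finite_classes_fba (G : groupType) (K : set G) :
  subgroup K -> finite_by_abelian K -> finite_classes K.
Proof.
move=> sK [N [nN finN abN]] c Kc.
apply: (@sub_finite_set _ _ ((fun n => c * n) @` N)); last exact: finite_image.
move=> _ [x Kx <-]; exists [~ c, x]; first exact: commutator_mem abN Kc Kx.
by rewrite commgEl mulVKg.
Qed.

(** The subgroup [M] is [L N], for [N] finite normal with [K / N] abelian. It is normal in [K]
    because it contains all commutators, and the elements of [N] represent its cosets modulo [L]. *)
Lemma normal_hull (G : groupType) (L K : set G) :
  subgroup L -> subgroup K -> L `<=` K -> finite_by_abelian K ->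
  exists M, [/\ subgroup M, L `<=` M, M `<=` K,
    forall m k, M m -> K k -> M (m ^ k) & finite_index L M].
Proof.
move=> sL sK LK [N [nN finN abN]]; have [sN NK conjN] := nN.
have N1 := subgroup1 sN; have L1 := subgroup1 sL.
have LM : L `<=` set_mulg L N by move=> l Ll; exists l => //; exists 1; rewrite ?mulg1.
have NM : N `<=` set_mulg L N by move=> n Nn; exists 1 => //; exists n; rewrite ?mul1g.
have MK : set_mulg L N `<=` K.
  by move=> _ [l Ll [n Nn <-]]; apply: subgroupM => //; [exact: LK | exact: NK].
have sM : subgroup (set_mulg L N).
  apply/subgroupP; split=> [|_ _ [l Ll [n Nn <-]] [l' Ll' [n' Nn' <-]]].
    exact: LM.
  exists (l / l'); first by apply: subgroupM => //; exact: subgroupV.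
  exists ((n / n') ^ l'^-1).
    apply: conjN; first by apply: subgroupV => //; exact: LK.
    by apply: subgroupM => //; exact: subgroupV.
  by rewrite conjgE invgK invgM !mulgA mulgVK.
exists (set_mulg L N); split=> //.
- move=> m k Mm Kk; have -> : m ^ k = m * [~ m, k] by rewrite commgEl mulVKg.
  by apply: subgroupM => //; apply: NM; apply: commutator_mem abN _ Kk => //; exact: MK.
- exists N => // _ [l Ll [n Nn <-]]; exists (n ^ l^-1), l; split=> //.
    by apply: conjN => //; apply: subgroupV => //; exact: LK.
  by rewrite conjgCV.
Qed.

Lemma adjoin_normal_cover (G : groupType) (L M : set G) h x :
  subgroup M -> L `<=` M ->
  (forall m k, M m -> adjoin L h k -> M (m ^ k)) ->
  adjoin L h x -> exists z m, M m /\ x = expgz h z * m.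
Proof.
move=> sM LM conjM; have sA : subgroup (adjoin L h) by exact: subgroup_generated.
pose P := [set x | exists z m, M m /\ x = expgz h z * m].
suff PA : adjoin L h `<=` P by move/PA.
have M1 := subgroup1 sM.
apply: adjoin_min => [|l /LM Ml|]; last first.
- by exists 1%R, 1; rewrite mulg1 /= expg1.
- by exists 0%R, l; rewrite mul1g.
apply/subgroupP; split=> [|_ _ [z [m [Mm ->]]] [w [m' [Mm' ->]]]].
  by exists 0%R, 1; rewrite mulg1.
exists (z - w)%R, ((m / m') ^ expgz h (- w)%R); split.
  apply: conjM; first by apply: subgroupM => //; exact: subgroupV.
  exact: (subgroup_expgz _ sA (@mem_adjoin _ L h)).
by rewrite conjgE expgzD !expgzN invgK invgM !mulgA mulgVK.
Qed.

Lemma power_finite_index (G : groupType) (L M K : set G) h m :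
  subgroup M -> (0 < m)%N -> M (h ^+ m) ->
  (forall x, K x -> exists z m, M m /\ x = expgz h z * m) ->
  finite_index L M -> finite_index L K.
Proof.
move=> sM m0 Mh cov LM; apply: finite_index_trans LM _.
exists [set h ^+ i | i in `I_m]; first exact: finite_image (finite_II m).
move=> x /cov [z [u [Mu ->]]].
have [zm0 zm1] : (0 <= (z %% m%:Z)%Z /\ (z %% m%:Z)%Z < m%:Z)%R.
  by split; [apply: modz_ge0 | apply: ltz_pmod]; lia.
exists (h ^+ `|(z %% m%:Z)%Z|%N), (expgz h ((z %/ m%:Z)%Z * m%:Z)%R * u); split.
- by exists `|(z %% m%:Z)%Z|%N => //=; lia.
- apply: subgroupM => //.
  by rewrite expgzM; exact: subgroup_expgz.
- rewrite mulgA; congr (_ * _); rewrite {1}(divz_eq z m) addrC expgzD.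
  by congr (_ * _); rewrite -{1}(gez0_abs zm0).
Qed.

(** Representatives are kept greedily, starting from 1, so that the digit 0 can stand for the
    trivial coset. *)
Lemma transversal (G : groupType) (L K : set G) :
  subgroup L -> subgroup K -> L `<=` K -> finite_index L K ->
  exists r : seq G, [/\ nth 1 r 0 = 1, (0 < size r)%N,
    forall i, (i < size r)%N -> K (nth 1 r i),
    forall x, K x -> exists2 i, (i < size r)%N & L ((nth 1 r i)^-1 * x) &
    forall i j, (i < size r)%N -> (j < size r)%N ->
      L ((nth 1 r i)^-1 * nth 1 r j) -> i = j].
Proof.
move=> sL sK LK [T /finite_seqP [s ->] sP].
have [r [r0 r1 rK rcov rinj]] : exists r : seq G, [/\ nth 1 r 0 = 1,
    (0 < size r)%N, forall i, (i < size r)%N -> K (nth 1 r i),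
    forall x, x \in s -> K x ->
      exists2 i, (i < size r)%N & L ((nth 1 r i)^-1 * x) &
    forall i j, (i < size r)%N -> (j < size r)%N ->
      L ((nth 1 r i)^-1 * nth 1 r j) -> i = j].
  elim: s {sP} => [|y s [r [r0 r1 rK rcov rinj]]].
    exists [:: 1]; split=> // [i|i j].
      by rewrite ltnS leqn0 => /eqP ->; exact: subgroup1.
    by rewrite !ltnS !leqn0 => /eqP -> /eqP ->.
  have [[Ky nocov]|cov] := pselect (K y /\
      forall i, (i < size r)%N -> ~ L ((nth 1 r i)^-1 * y)); last first.
    exists r; split=> // x; rewrite inE => /orP[/eqP ->|/rcov //] Ky.
    by apply: contrapT => no; apply: cov; split=> // i ir Ly; apply: no; exists i.
  exists (rcons r y); rewrite size_rcons; split.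
  - by rewrite nth_rcons r1.
  - by [].
  - move=> i; rewrite ltnS nth_rcons leq_eqVlt => /orP[/eqP ->|ir].
      by rewrite ltnn eqxx.
    by rewrite ir; exact: rK.
  - move=> x; rewrite inE => /orP[/eqP -> _|/rcov H /H [i ir Lx]].
      exists (size r) => //; rewrite nth_rcons ltnn eqxx mulVg.
      exact: subgroup1.
    by exists i; [exact: ltnW | rewrite nth_rcons ir].
  - move=> i j; rewrite !ltnS !nth_rcons (leq_eqVlt i) (leq_eqVlt j).
    move=> /orP[/eqP->|ir] /orP[/eqP->|jr]; rewrite ?ltnn ?eqxx ?ir ?jr //.
    + by move/(subgroupV sL); rewrite invgM invgK => /(nocov _ jr).
    + by move/(nocov _ ir).
    + exact: rinj.
exists r; split=> // x Kx; have [t [l [ts Ll xE]]] := sP x Kx.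
have Kt : K t.
  by rewrite -[t](mulgK l) -xE; apply: subgroupM => //; apply: subgroupV => //; exact: LK.
have [i ir Lt] := rcov t ts Kt; exists i => //.
by rewrite xE mulgA; exact: subgroupM.
Qed.

Definition digit_set (a : nat) : set int := [set s : int | (0 <= s < a%:Z)%R].

Lemma digit_lt a s : digit_set a s -> (`|s| < a)%N /\ s = `|s|%N%:Z.
Proof. by rewrite /digit_set /mkset => sa; split; lia. Qed.

Lemma digit_nat a i : (i < a)%N -> digit_set a i%:Z.
Proof. by rewrite /digit_set /mkset => ia; lia. Qed.

Lemma finite_step (G : groupType) (L K : set G) :
  subgroup L -> subgroup K -> L `<=` K -> finite_index L K ->
  exists (a : nat) (t : int -> G), (0 < a)%N /\
    coset_step L K (digit_set a) t.
Proof.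
move=> sL sK LK fLK; have [r [r0 r1 rK rcov rinj]] := transversal sL sK LK fLK.
exists (size r), (fun s => nth 1 r `|s|%N); split=> //; split=> //.
- by move=> s /digit_lt [sr _]; exact: rK.
- move=> x Kx; have [i ir Lx] := rcov x Kx.
  by exists i%:Z, ((nth 1 r i)^-1 * x); rewrite mulVKg; split=> //; exact: digit_nat.
- by move=> s s' /digit_lt [sr ->] /digit_lt [sr' ->] /= /rinj ->.
- move=> B; pose R := [set x | x \in r].
  have finR : finite_set R by apply/finite_seqP; exists r.
  apply: (@sub_finite_set _ _ [set u^-1 * v | u in R & v in R]); last first.
    exact: finite_image2.
  move=> _ [s [s' [/digit_lt [sr _] /digit_lt [sr' _] _ ->]]].
  exists (nth 1 r `|s|%N); first exact: mem_nth.
  by exists (nth 1 r `|s'|%N) => //; exact: mem_nth.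
- move=> F _; exists (size r) => s s' l l'.
  by move=> /digit_lt [sr ->] /digit_lt [sr' ->] _ _ _; lia.
Qed.

(** The quotient [K / M] is infinite cyclic, generated by [h], and [L] has a finite index [a] in
    [M]. The digit [q a + i], with [0 <= i < a], stands for the power [q] of [h] times
    representative [i] of [M] modulo [L]. *)
Lemma infinite_step (G : groupType) (L M K : set G) h :
  subgroup L -> subgroup M -> subgroup K -> L `<=` M -> M `<=` K -> K h ->
  (forall m k, M m -> K k -> M (m ^ k)) ->
  (forall x, K x -> exists z m, M m /\ x = expgz h z * m) ->
  (forall m, (0 < m)%N -> ~ M (h ^+ m)) -> finite_index L M ->
  exists t, coset_step L K setT t.
Proof.
move=> sL sM sK LM MK Kh conjM cov noM fLM.
have [r [r0 r1 rM rcov rinj]] := transversal sL sM LM fLM.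
have Mexp z : M (expgz h z) -> z = 0%R.
  case: z => [[|m]|m] //= Mz; first by case: (noM m.+1).
  by case: (noM m.+1) => //; rewrite -[_ ^+ _]invgK; exact: subgroupV.
pose a := (size r)%:Z; have a0 : (0 < a)%R by [].
pose q (s : int) := (s %/ a)%Z; pose i (s : int) := `|(s %% a)%Z|%N.
have iP s : (i s < size r)%N /\ (i s)%:Z = (s %% a)%Z.
  have := modz_ge0 s (lt0r_neq0 a0); have := ltz_pmod s a0; rewrite /i /a; lia.
have sE s : s = (q s * a + (i s)%:Z)%R by have [_ ->] := iP s; exact: divz_eq.
have a1 : (1 <= a)%R by rewrite /a lez_nat.
have diff s s' : exists e, (s' - s = (q s' - q s) * a + e /\ `|e| < a)%R.
  exists ((i s')%:Z - (i s)%:Z)%R; split.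
    have := sE s; have := sE s'; move: (q s) (q s') (i s)%:Z (i s')%:Z.
    by move=> u v w z -> ->; rewrite mulrBl opprD addrACA.
  by have [h1 _] := iP s; have [h2 _] := iP s'; rewrite /a; lia.
have q_le s s' (B : nat) : (`|s - s'| <= B%:Z)%R -> (`|q s' - q s| <= B%:Z)%R.
  have [e []] := diff s s'; move: (q s' - q s)%R => d.
  move=> E ea sB; rewrite leNgt; apply/negP => dB.
  have h1 : ((B%:Z + 1) * a <= `|d| * a)%R by rewrite ler_wpM2r //; lia.
  have h2 : (B%:Z <= B%:Z * a)%R by rewrite ler_peMr.
  have h3 : (`|d| * a = `|d * a|)%R by rewrite normrM (gtr0_norm a0).
  rewrite h3 mulrDl mul1r in h1.
  by clear -E ea sB h1 h2; move: (d * a)%R (B%:Z * a)%R h1 h2 E => x y; lia.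
pose t s := expgz h (q s) * nth 1 r (i s).
have tVt s s' : (t s)^-1 * t s' =
    (nth 1 r (i s))^-1 * expgz h (q s' - q s)%R * nth 1 r (i s').
  by rewrite /t invgM addrC expgzD expgzN !mulgA.
have qi s s' : q s = q s' -> i s = i s' -> s = s'.
  by move=> qq ii; rewrite (sE s) (sE s') qq ii.
have Mr s : M (nth 1 r (i s)) by apply: rM; case: (iP s).
exists t; split=> //.
- by rewrite /t /q /i div0z mod0z r0 mulg1.
- move=> s _; apply: subgroupM => //; last exact: MK.
  exact: subgroup_expgz.
- move=> x /cov [z [m [Mm ->]]]; have [j jr Lm] := rcov m Mm.
  have qj : q (z * a + j%:Z)%R = z.
    by rewrite /q divzMDl ?gt_eqF // divz_small ?addr0 //; rewrite /a; lia.
  have ij : i (z * a + j%:Z)%R = j.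
    by rewrite /i modzMDl modz_small //; rewrite /a; lia.
  exists (z * a + j%:Z)%R, ((nth 1 r j)^-1 * m).
  by rewrite /t qj ij -mulgA mulVKg.
- move=> s s' _ _; rewrite tVt => Lss.
  have qq : q s = q s'.
    suff /Mexp : M (expgz h (q s' - q s)%R) by lia.
    rewrite -[expgz _ _](mulKg (nth 1 r (i s))^-1) invgK.
    rewrite -[_^-1 * _](mulgK (nth 1 r (i s'))).
    apply: subgroupM => //; apply: subgroupM => //; first exact: LM.
    by apply: subgroupV.
  apply: qi => //; apply: rinj; [by case: (iP s) | by case: (iP s') |].
  by move: Lss; rewrite qq subrr mulg1.
- move=> B; pose R := [set x | x \in r].
  have finR : finite_set R by apply/finite_seqP; exists r.
  pose D := [set expgz h (d%:Z - B%:Z)%R | d in `I_(2 * B).+1].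
  have finD : finite_set D by exact: finite_image (finite_II _).
  pose A := [set u^-1 * v | u in R & v in D].
  have finA : finite_set A by exact: finite_image2.
  apply: sub_finite_set (finite_image2 (fun u v => u * v) finA finR).
  move=> _ [s [s' [_ _ ss ->]]]; rewrite tVt.
  have Rr u : R (nth 1 r (i u)) by apply: mem_nth; case: (iP u).
  exists ((nth 1 r (i s))^-1 * expgz h (q s' - q s)%R); last by exists (nth 1 r (i s')).
  exists (nth 1 r (i s)) => //; exists (expgz h (q s' - q s)%R) => //.
  have qB : (`|q s' - q s| <= B%:Z)%R by exact: q_le.
  exists `|(q s' - q s + B%:Z)%R|%N => /=; first by lia.
  by congr expgz; lia.
- move=> F finF.
  pose P f (n : nat) := forall s s' l l', L l -> L l' ->
    l * ((t s)^-1 * t s') * l' = f -> (`|s - s'| <= n%:Z)%R.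
  have [|f _|n nP] := @finite_set_bound _ F P finF.
  + by move=> f m n mn Pf s s' l l' Ll Ll' /(Pf _ _ _ _ Ll Ll') /le_trans; apply; rewrite lez_nat.
  + have [[d [m [m' [Mm Mm' fE]]]]|nof] := pselect (exists d m m', [/\ M m, M m' &
        f = m * expgz h d * m']); last first.
      exists 0%N => s s' l l' Ll Ll'; rewrite tVt => fE; case: nof.
      exists (q s' - q s)%R, (l * (nth 1 r (i s))^-1), (nth 1 r (i s') * l').
      split; [| |by rewrite -fE !mulgA].
        by apply: subgroupM => //; [exact: LM | exact: subgroupV].
      by apply: subgroupM => //; exact: LM.
    (* The exponent of [h] modulo [M] is well defined, so [q s' - q s = d]; the remainders differ by
       less than [size r]. *)
    exists ((`|d| + 1) * size r)%N => s s' l l' Ll Ll'; rewrite tVt => E.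
    have dE : (q s' - q s)%R = d.
      suff /Mexp : M (expgz h (q s' - q s - d)%R) by lia.
      pose u := (l * (nth 1 r (i s))^-1)^-1 * m.
      pose v := m' * (nth 1 r (i s') * l')^-1.
      have Mu : M u.
        apply: subgroupM => //; apply: subgroupV => //; apply: subgroupM => //.
          exact: LM.
        exact: subgroupV.
      have Mv : M v.
        apply: subgroupM => //; apply: subgroupV => //; apply: subgroupM => //.
        exact: LM.
      have -> : expgz h (q s' - q s - d)%R = u * v ^ expgz h (- d)%R.
        have E2 : l * (nth 1 r (i s))^-1 * expgz h (q s' - q s)%R *
            (nth 1 r (i s') * l') = m * expgz h d * m' by rewrite -fE -E !mulgA.
        rewrite expgzD conjgE !expgzN invgK !mulgA; congr (_ / _).
        rewrite /u /v; move: E2; move: (l * _^-1) (_ * l') (expgz h _) (expgz h d).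
        move=> x y z w E2; apply: (mulIg y); apply: (mulgI x).
        by rewrite !mulgA mulgVK mulgV mul1g.
      apply: subgroupM => //; apply: conjM => //.
      exact: subgroup_expgz.
    have [e [E' ea]] := diff s s'; rewrite dE in E'.
    have -> : (((`|d| + 1) * size r)%N%:Z = `|d| * a + a)%R.
      by rewrite PoszM PoszD abszE mulrDl mul1r.
    rewrite distrC E' (le_trans (ler_normD _ _)) //.
    by rewrite normrM (gtr0_norm a0) lerD2l ltW.
  + exists n => s s' l l' _ _ Ll Ll' /nP H; exact: H Ll Ll' erefl.
Qed.

(** * Exhausting the group, with steps of infinite index first *)

Definition stuck (G : groupType) (L : set G) : Prop :=
  forall h, finite_index L (adjoin L h).

Lemma adjoin_power_finite_index (G : groupType) (L : set G) h m :
  locally_finite_by_abelian G -> fg_subgroup L -> (0 < m)%N -> L (h ^+ m) ->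
  finite_index L (adjoin L h).
Proof.
move=> lfa fgL m0 Lh; have [sL _] := fgL.
have [sA fgA] := fg_adjoin h fgL.
have [M [sM LM MA conjM LMi]] := normal_hull sL sA (@sub_adjoin _ L h) (lfa _ sA fgA).
apply: (power_finite_index sM m0 (LM _ Lh)) LMi => x.
exact: adjoin_normal_cover.
Qed.

Lemma adjoin_infinite_step (G : groupType) (L0 L : set G) h :
  locally_finite_by_abelian G -> fg_subgroup L -> subgroup L0 -> L0 `<=` L ->
  finite_index L0 L -> ~ finite_index L (adjoin L h) ->
  exists t, coset_step L0 (adjoin L h) setT t.
Proof.
move=> lfa fgL sL0 L0L fiL nofi; have [sL _] := fgL.
have [sA fgA] := fg_adjoin h fgL.
have [M [sM LM MA conjM LMi]] := normal_hull sL sA (@sub_adjoin _ L h) (lfa _ sA fgA).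
have cov x : adjoin L h x -> exists z m, M m /\ x = expgz h z * m.
  exact: adjoin_normal_cover.
apply: (infinite_step sL0 sM sA _ MA (@mem_adjoin _ L h) conjM cov).
- by apply: subset_trans LM.
- by move=> m m0 Mh; apply: nofi; exact: power_finite_index m0 Mh cov LMi.
- exact: finite_index_trans LMi.
Qed.

Lemma finite_index_power (G : groupType) (L K : set G) h :
  subgroup L -> subgroup K -> finite_index L K -> K h ->
  exists2 m, (0 < m)%N & L (h ^+ m).
Proof.
move=> sL sK [T /finite_seqP [s ->] sP] Kh.
have /choice [f fP] : forall i : nat, exists t, t \in s /\ L (t^-1 * h ^+ i).
  move=> i; have [t [l [ts Ll E]]] := sP _ (subgroupX i sK Kh).
  by exists t; split=> //; rewrite E mulKg.
apply: contrapT => no.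
have finj : injective f.
  move=> i j; wlog ij : i j / (i <= j)%N => [H|] fij.
    by case/orP: (leq_total i j) => ij; [|apply/esym]; apply: H.
  move: ij; rewrite leq_eqVlt => /orP[/eqP//|ij]; case: no.
  exists (j - i)%N; first by rewrite subn_gt0.
  have [_ Li] := fP i; have [_ Lj] := fP j.
  have -> : h ^+ (j - i) = ((f i)^-1 * h ^+ i)^-1 * ((f j)^-1 * h ^+ j).
    rewrite fij invgM invgK -mulgA mulVKg -{2}(subnKC (ltnW ij)) expgnDr.
    by rewrite mulKg.
  by apply: subgroupM => //; exact: subgroupV.
have : (size (map f (iota 0 (size s).+1)) <= size s)%N.
  apply: uniq_leq_size; first by rewrite map_inj_uniq ?iota_uniq.
  by move=> _ /mapP [i _ ->]; case: (fP i).
by rewrite size_map size_iota ltnn.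
Qed.

(** For a finitely generated subgroup, being stuck amounts to containing a positive power of every
    element, which larger subgroups inherit. *)
Lemma stuck_le (G : groupType) (L L' : set G) :
  locally_finite_by_abelian G -> fg_subgroup L -> fg_subgroup L' ->
  L `<=` L' -> stuck L -> stuck L'.
Proof.
move=> lfa [sL _] fgL' LL' stL h.
have [|m m0 Lh] := finite_index_power sL _ (stL h) (@mem_adjoin _ L h).
  exact: subgroup_generated.
by apply: (adjoin_power_finite_index lfa fgL' m0); exact: LL'.
Qed.

Definition step_range (o : option nat) : set int :=
  if o is Some a then digit_set a else setT.

(** Absorbing [g] makes the tower exhaust the group. The step is nevertheless infinite unless [K] is
    stuck, so that no infinite step can follow a finite one. *)
Lemma next_step (G : groupType) (K : set G) g :
  locally_finite_by_abelian G -> fg_subgroup K ->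
  exists K' t o, [/\ fg_subgroup K', K `<=` K', K' g,
    coset_step K K' (step_range o) t &
    if o is Some a then (0 < a)%N /\ stuck K else ~ stuck K].
Proof.
move=> lfa fgK; have [sK _] := fgK; have fgA := fg_adjoin g fgK.
have [stK|nst] := pselect (stuck K).
  have [|a [t [a0 st]]] := finite_step sK _ (@sub_adjoin _ K g) (stK g).
    by case: fgA.
  exists (adjoin K g), t, (Some a); split=> //; first exact: sub_adjoin.
  exact: mem_adjoin.
have [fi|nfi] := pselect (finite_index K (adjoin K g)); last first.
  have fiK : finite_index K K.
    exists [set 1]; first exact: finite_set1.
    by move=> x Kx; exists 1, x; rewrite mul1g.
  have [t st] := adjoin_infinite_step lfa fgK sK (fun x h => h) fiK nfi.
  exists (adjoin K g), t, None; split=> //; first exact: sub_adjoin.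
  exact: mem_adjoin.
(* Here [g] alone gives a finite index. An element [h] that witnesses that [K] is not stuck is
   adjoined as well, and both extensions form one infinite step. *)
have /existsNP [h nfi] := nst.
have sub1 : K `<=` adjoin (adjoin K g) h.
  by apply: subset_trans (@sub_adjoin _ K g) _; exact: sub_adjoin.
have sub2 : adjoin K h `<=` adjoin (adjoin K g) h.
  by apply: adjoin_min => //; [exact: subgroup_generated | exact: mem_adjoin].
have nfi' : ~ finite_index (adjoin K g) (adjoin (adjoin K g) h).
  move=> /(finite_index_trans fi) fi'; apply: nfi.
  by apply: (finite_index_sub _ sub2) fi' => //; exact: subset_refl.
have [t st] := adjoin_infinite_step lfa fgA sK (@sub_adjoin _ K g) fi nfi'.
exists (adjoin (adjoin K g) h), t, None; split=> //; first exact: fg_adjoin.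
by apply: sub_adjoin; exact: mem_adjoin.
Qed.

Lemma countable_enumeration (T : Type) (x0 : T) :
  countable [set: T] -> exists g : nat -> T, forall x, exists n, g n = x.
Proof.
case/countable_injP => f /(_ _ _ (in_setT _) (in_setT _)) finj.
have /choice [g gP] : forall n, exists x, forall y, f y = n -> x = y.
  move=> n; have [[y fy]|no] := pselect (exists y, f y = n).
    by exists y => z fz; apply: finj; rewrite fy fz.
  by exists x0 => y fy; case: no; exists y.
by exists g => x; exists (f x); exact: gP.
Qed.

Lemma fg_trivial (G : groupType) : fg_subgroup [set (1 : G)].
Proof.
have s1 : subgroup [set (1 : G)].
  by apply/subgroupP; split=> // x y -> ->; rewrite divg1.
split=> //; exists set0; first exact: finite_set0.
rewrite eqEsubset; split; first exact: generated_min.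
by move=> x ->; apply: subgroup1; exact: subgroup_generated.
Qed.

Lemma exists_tower (G : groupType) :
  locally_finite_by_abelian G -> countable [set: G] ->
  exists (K : nat -> set G) (t : nat -> int -> G) (o : nat -> option nat),
    [/\ coset_tower K (fun n => step_range (o n)) t,
    forall n, fg_subgroup (K n) &
    forall n, if o n is Some a then (0 < a)%N /\ stuck (K n) else ~ stuck (K n)].
Proof.
move=> lfa /(countable_enumeration 1) [g gP].
have /choice [next nextP] : forall z : set G * G,
    exists w : set G * (int -> G) * option nat, fg_subgroup z.1 ->
    [/\ fg_subgroup w.1.1, z.1 `<=` w.1.1, w.1.1 z.2,
        coset_step z.1 w.1.1 (step_range w.2) w.1.2 &
        if w.2 is Some a then (0 < a)%N /\ stuck z.1 else ~ stuck z.1].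
  move=> [K h]; have [fgK|nf] := pselect (fg_subgroup K).
    by have [K' [t [o H]]] := next_step h lfa fgK; exists (K', t, o).
  by exists (set0, fun=> 1, None).
pose K := fix K n := if n is m.+1 then (next (K m, g m)).1.1 else [set 1].
pose t n := (next (K n, g n)).1.2; pose o n := (next (K n, g n)).2.
have fgK n : fg_subgroup (K n).
  elim: n => [|n /(nextP (K n, g n)) [] //]; exact: fg_trivial.
exists K, t, o; split=> // [|n]; last by have [] := nextP (K n, g n) (fgK n).
split=> // [n|n|n|x|n].
- by case: (fgK n).
- by have [] := nextP (K n, g n) (fgK n).
- by have [] := nextP (K n, g n) (fgK n).
- by have [n <-] := gP x; exists n.+1; have [] := nextP (K n, g n) (fgK n).
- by have [sK fg] := fgK n; apply: finite_classes_fba => //; exact: lfa.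
Qed.

(** * Models of the coarse types *)

(** Numeration in the mixed bases [a 0], [a 1], and so on: finitely supported digit sequences are
    natural numbers, and agreement from position [n] on means lying in one block of size
    [place_value a n]. *)
Definition place_value (a : nat -> nat) (n : nat) : nat := (\prod_(i < n) a i)%N.

Definition digit (a : nat -> nat) (m j : nat) : nat :=
  ((m %/ place_value a j) %% a j)%N.

Lemma place_valueS a n : place_value a n.+1 = (place_value a n * a n)%N.
Proof. by rewrite /place_value big_ord_recr. Qed.

Lemma place_value_chain a : (forall n, (0 < a n)%N) -> divisor_chain (place_value a).
Proof.
move=> a0 n; split; last by rewrite place_valueS dvdn_mulr.
by rewrite /place_value prodn_gt0.
Qed.

Lemma divn_place_value a m j : (m %/ place_value a j =
  m %/ place_value a j.+1 * a j + digit a m j)%N.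
Proof. by rewrite place_valueS divnMA -divn_eq. Qed.

Lemma eq_digits a m m' n : (forall i, (0 < a i)%N) -> unbounded (place_value a) ->
  (forall j, (n <= j)%N -> digit a m j = digit a m' j) ->
  block_scales (place_value a) n m m'.
Proof.
move=> a0 ua dmm'; have ca := place_value_chain a0.
have [k kP] := ua (maxn m m').
have nk : (n <= maxn n k)%N by exact: leq_maxl.
have : block_scales (place_value a) (maxn n k) m m'.
  have kle : (place_value a k <= place_value a (maxn n k))%N.
    apply: dvdn_leq; first by case: (ca (maxn n k)).
    by apply: divisor_chain_dvd => //; exact: leq_maxr.
  by rewrite /block_scales !divn_small //; lia.
move: (maxn n k) nk => l /subnKC <-.
elim: (l - n)%N => [|d IHd]; first by rewrite addn0.
rewrite addnS => H; apply: IHd.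
by rewrite /block_scales divn_place_value [RHS]divn_place_value H dmm' ?leq_addr.
Qed.

Lemma digit_block_scales a m m' n j : (forall i, (0 < a i)%N) -> (n <= j)%N ->
  block_scales (place_value a) n m m' -> digit a m j = digit a m' j.
Proof.
move=> a0 nj mm'; rewrite /digit; congr (_ %% _)%N; move: mm'.
by apply: divn_eq_dvd; apply: divisor_chain_dvd => //; exact: place_value_chain.
Qed.

Lemma ltn_digit a m j : (forall i, (0 < a i)%N) -> (digit a m j < a j)%N.
Proof. by move=> a0; rewrite ltn_mod. Qed.

Lemma digit_small a m j : (m < place_value a j)%N -> digit a m j = 0%N.
Proof. by move=> mj; rewrite /digit divn_small // mod0n. Qed.

Lemma exists_digits a (x : nat -> nat) n : (forall i, (x i < a i)%N) ->
  exists2 m, (m < place_value a n)%N & forall j, (j < n)%N -> digit a m j = x j.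
Proof.
move=> xa; have a0 i : (0 < a i)%N by apply: leq_ltn_trans (xa i).
have ca := place_value_chain a0.
elim: n => [|n [m mn IHn]]; first by exists 0%N => //; rewrite /place_value big_ord0.
have [pn0 _] := ca n; exists (x n * place_value a n + m)%N.
  rewrite place_valueS [X in (_ < X)%N]mulnC.
  apply: (@leq_trans ((x n).+1 * place_value a n)).
    by rewrite mulSn; lia.
  by rewrite leq_mul2r xa orbT.
move=> j; rewrite ltnS leq_eqVlt => /orP[/eqP ->|jn].
  by rewrite /digit divnMDl // divn_small // addn0 modn_small.
have /dvdnP [q qE] : (place_value a j.+1 %| place_value a n)%N.
  exact: divisor_chain_dvd.
have [pj0 _] := ca j.
rewrite -(IHn j jn) /digit qE place_valueS.
have -> : (x n * (q * (place_value a j * a j)) + m =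
           (x n * q * a j) * place_value a j + m)%N by ring.
by rewrite divnMDl // modnMDl.
Qed.

Definition prefix_coordinates r (z : {ffun 'I_r -> int}) (x : nat -> int) (i : nat) :
    int := if insub i is Some l then z l else x i.

Lemma prefix_coordinates_lt r z x (l : 'I_r) : prefix_coordinates z x l = z l.
Proof. by rewrite /prefix_coordinates valK. Qed.

Lemma prefix_coordinates_ge r (z : {ffun 'I_r -> int}) x i :
  (r <= i)%N -> prefix_coordinates z x i = x i.
Proof. by move=> ri; rewrite /prefix_coordinates insubF // ltnNge ri. Qed.

Lemma prefix_coordinatesP r (z : {ffun 'I_r -> int}) x (i : nat) :
  (exists2 l : 'I_r, i = l :> nat & prefix_coordinates z x i = z l) \/
  (r <= i)%N /\ prefix_coordinates z x i = x i.
Proof.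
have [ri|ir] := leqP r i; first by right; rewrite prefix_coordinates_ge.
by left; exists (Ordinal ir) => //; exact: (prefix_coordinates_lt z x (Ordinal ir)).
Qed.

Lemma embed_coordinates r : exists f : {ffun 'I_r -> int} -> coordinates (fun=> setT),
  controlled (@zscales r) (@coordinate_scales (fun=> setT)) f /\
  expansive (@zscales r) (@coordinate_scales (fun=> setT)) f.
Proof.
have fP (z : {ffun 'I_r -> int}) :
    finite_coordinates (fun=> setT) (prefix_coordinates z (fun=> 0%R)).
  by split=> //; exists r => i ri; rewrite prefix_coordinates_ge.
exists (fun z => exist (finite_coordinates _) _ (fP z)); split=> n.
  exists (maxn r n) => x y xy i /=.
  have [[l -> _]|[ri _]] := prefix_coordinatesP x (fun=> 0%R) i.
    rewrite !prefix_coordinates_lt; split; first by have := ltn_ord l; lia.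
    by have := xy l; lia.
  by rewrite !prefix_coordinates_ge // subrr normr0.
exists n => x y xy l; have [_] := xy l.
by rewrite /= !prefix_coordinates_lt.
Qed.

Lemma digit_le_sum (a : nat -> nat) j n : (j < n)%N -> (a j <= \sum_(i < n) a i)%N.
Proof. by move=> jn; rewrite (bigD1 (Ordinal jn)) //= leq_addr. Qed.

(** Only finitely many finite bases exceed 1, so replacing all finite digits by 0 moves a point by a
    bounded amount. *)
Lemma finite_digits_model r (o : nat -> option nat) (a : nat -> nat) J :
  (forall i, (i < r)%N -> o i = None) ->
  (forall i, (r <= i)%N -> o i = Some (a (i - r)%N)) ->
  (forall j, (0 < a j)%N) -> (forall j, (J <= j)%N -> a j = 1%N) ->
  coarse_iso (@zscales r) (@coordinate_scales (fun i => step_range (o i))).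
Proof.
move=> oN oS a0 a1.
have fP (z : {ffun 'I_r -> int}) :
    finite_coordinates (fun i => step_range (o i)) (prefix_coordinates z (fun=> 0%R)).
  split=> [i|]; last by exists r => i ri; rewrite prefix_coordinates_ge.
  have [ri|ir] := leqP r i; last by rewrite oN.
  by rewrite prefix_coordinates_ge // oS //; exact: digit_nat (a0 _).
exists (fun z => exist (finite_coordinates _) _ (fP z)); split=> [n|n|].
- exists (maxn r n) => x y xy i /=.
  have [[l -> _]|[ri _]] := prefix_coordinatesP x (fun=> 0%R) i.
    rewrite !prefix_coordinates_lt; split; first by have := ltn_ord l; lia.
    by have := xy l; lia.
  by rewrite !prefix_coordinates_ge // subrr normr0.
- by exists n => x y xy l; have [_] := xy l; rewrite /= !prefix_coordinates_lt.
- exists (r + J + \sum_(i < J) a i)%N => x.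
  pose z : {ffun 'I_r -> int} := [ffun l : 'I_r => sval x l]; exists z => i /=.
  have [[l -> _]|[ri _]] := prefix_coordinatesP z (fun=> 0%R) i.
    by rewrite prefix_coordinates_lt ffunE subrr normr0.
  rewrite prefix_coordinates_ge //; have [Sx _] := svalP x.
  have := Sx i; rewrite oS // => /digit_lt [xa ->].
  have [Ji|iJ] := leqP J (i - r).
    by move: xa; rewrite a1 // ltnS leqn0 => /eqP ->.
  have := digit_le_sum a iJ; move: (\sum_(j < J) a j)%N `|sval x i|%N xa => B v.
  by split; lia.
Qed.

Lemma infinite_digits_model r (o : nat -> option nat) (a : nat -> nat) :
  (forall i, (i < r)%N -> o i = None) ->
  (forall i, (r <= i)%N -> o i = Some (a (i - r)%N)) ->
  (forall j, (0 < a j)%N) -> unbounded (place_value a) ->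
  coarse_iso (prod_scales (@zscales r) (block_scales (place_value a)))
             (@coordinate_scales (fun i => step_range (o i))).
Proof.
move=> oN oS a0 ua; have ca := place_value_chain a0.
pose d (m i : nat) : int := (digit a m (i - r))%:Z.
have fP (z : {ffun 'I_r -> int} * nat) :
    finite_coordinates (fun i => step_range (o i)) (prefix_coordinates z.1 (d z.2)).
  split=> [i|].
    have [ri|ir] := leqP r i; last by rewrite oN.
    by rewrite prefix_coordinates_ge // oS //; apply: digit_nat; exact: ltn_digit.
  have [k kP] := ua z.2; exists (r + k)%N => i ki.
  rewrite prefix_coordinates_ge; last by lia.
  rewrite /d digit_small //; apply: leq_trans kP _; apply: dvdn_leq.
    by case: (ca (i - r)%N).
  by apply: divisor_chain_dvd => //; lia.
exists (fun z => exist (finite_coordinates _) _ (fP z)); split=> [n|n|].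
- exists (r + n + \sum_(i < n) a i)%N => x y [/= xy1 xy2] i /=.
  have [[l -> _]|[ri _]] := prefix_coordinatesP x.1 (d x.2) i.
    rewrite !prefix_coordinates_lt; split; first by have := ltn_ord l; lia.
    by have := xy1 l; lia.
  rewrite !prefix_coordinates_ge // /d; have [ni|iN] := leqP n (i - r).
    by rewrite (digit_block_scales a0 ni xy2) subrr normr0.
  split; first by lia.
  have := digit_le_sum a iN.
  have := ltn_digit x.2 (i - r) a0; have := ltn_digit y.2 (i - r) a0.
  move: (digit _ _ _) (digit _ _ _) (a (i - r)%N) (\sum_(j < n) a j)%N => u v w B.
  by lia.
- exists n => x y xy; split=> [l|].
    by have [_] := xy l; rewrite /= !prefix_coordinates_lt.
  apply: eq_digits => // j nj; have [/(_ _)] := xy (r + j)%N.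
  rewrite /= !prefix_coordinates_ge ?leq_addr // /d addKn => H _.
  by have := H (leq_trans nj (leq_addl _ _)); case.
- exists 0%N => x; have [Sx [k x0]] := svalP x.
  have xa i : (`|sval x (r + i)%N| < a i)%N /\ sval x (r + i)%N = `|sval x (r + i)%N|%N%:Z.
    by have := Sx (r + i)%N; rewrite oS ?leq_addr // addKn; exact: digit_lt.
  have [m mk mP] := @exists_digits a (fun i => `|sval x (r + i)%N|%N) k (fun i => (xa i).1).
  pose z : {ffun 'I_r -> int} := [ffun l : 'I_r => sval x l]; exists (z, m) => i /=.
  suff -> : prefix_coordinates z (d m) i = sval x i.
    by rewrite subrr normr0.
  have [[l -> _]|[ri _]] := prefix_coordinatesP z (d m) i.
    by rewrite prefix_coordinates_lt ffunE.
  rewrite prefix_coordinates_ge // /d.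
  have [ki|ik] := leqP k (i - r).
    rewrite digit_small ?x0 //; first by lia.
    apply: leq_trans mk _; apply: dvdn_leq; first by case: (ca (i - r)%N).
    exact: divisor_chain_dvd.
  by rewrite mP // subnKC //; have [_] := xa (i - r)%N; rewrite subnKC.
Qed.

(** If the bases were eventually 1, the tower would be stationary and the group equal to one of its
    finitely generated terms. So infinitely many bases are at least 2. *)
Lemma tower_unbounded (G : groupType) K (o : nat -> option nat) t r (a : nat -> nat) :
  @coset_tower G K (fun i => step_range (o i)) t ->
  (forall n, fg_subgroup (K n)) -> ~ finitely_generated [set: G] ->
  (forall i, (r <= i)%N -> o i = Some (a (i - r)%N)) ->
  (forall j, (0 < a j)%N) -> unbounded (place_value a).
Proof.
move=> tow fgK nfg oS a0.
have big J : exists2 j, (J <= j)%N & (1 < a j)%N.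
  apply: contrapT => no; apply: nfg.
  have a1 j : (J <= j)%N -> a j = 1%N.
    move=> Jj; apply/eqP; rewrite eqn_leq a0 andbT leqNgt; apply/negP => aj.
    by apply: no; exists j.
  have const d : K (r + J + d)%N `<=` K (r + J)%N.
    elim: d => [|d IHd]; first by rewrite addn0.
    apply: subset_trans IHd; rewrite addnS => x.
    move=> /(step_cover (tower_step tow _)) [s [l [Ss Kl ->]]].
    move: Ss; rewrite oS; last by lia.
    rewrite a1; last by lia.
    move=> /digit_lt [+ ->]; rewrite ltnS leqn0 => /eqP ->.
    by rewrite (step1 (tower_step tow _)) mul1g.
  have -> : [set: G] = K (r + J)%N.
    rewrite eqEsubset; split=> // g _; have [n Kg] := tower_cover tow g.
    by apply: (const n); apply: (tower_le_mono tow) Kg; exact: leq_addl.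
  by case: (fgK (r + J)%N).
have ca := place_value_chain a0.
elim=> [|N [n nP]]; first by exists 0%N; case: (ca 0%N).
have [j nj aj] := big n; exists j.+1; rewrite place_valueS.
have le : (place_value a n <= place_value a j)%N.
  by apply: dvdn_leq; [case: (ca j) | exact: divisor_chain_dvd].
by apply: (@leq_trans (place_value a j * 2)); [lia | rewrite leq_mul2l aj orbT].
Qed.

Definition finite_coarse_rank (G : groupType) (E : scales G) (r : nat) : Prop :=
  (finitely_generated [set: G] -> coarse_iso (@zscales r) E) /\
  (~ finitely_generated [set: G] -> exists A, [/\ divisor_chain A, unbounded A &
     coarse_iso (prod_scales (@zscales r) (block_scales A)) E]).

Lemma coarse_classification (G : groupType) (E : scales G) :
  locally_finite_by_abelian G -> countable [set: G] ->
  coarse_scales E -> proper_scales E ->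
  coarse_iso (@coordinate_scales (fun=> setT)) E \/ exists r, finite_coarse_rank E r.
Proof.
move=> lfa cG cE pE; have [K [t [o [tow fgK oP]]]] := exists_tower lfa cG.
have [oN|/existsNP oS0] := pselect (forall n, o n = None).
  have oE : o = fun=> None by apply/funext.
  by left; rewrite oE in tow; exact: coarse_iso_tower tow pE.
right.
have exo : exists n, o n != None by case: oS0 => n /eqP; exists n.
(* [r] is the index of the first finite step. Then [K r] is stuck, hence so are all later terms, and
   all later steps are finite. *)
case: (ex_minnP exo) => r or rmin; exists r.
have oN i : (i < r)%N -> o i = None.
  by move=> ir; apply/eqP; apply: contraTT ir => /rmin; rewrite -leqNgt.
pose a j := odflt 1%N (o (r + j)%N).
have stK i : (r <= i)%N -> stuck (K i).
  move=> ri; apply: stuck_le (tower_le_mono tow ri) _ => //.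
  by have := oP r; case: (o r) or => // b _ [].
have oS i : (r <= i)%N -> o i = Some (a (i - r)%N).
  move=> ri; rewrite /a subnKC //; have := oP i.
  by case: (o i) => // nst; case: nst; exact: stK.
have a0 j : (0 < a j)%N.
  by have := oP (r + j)%N; rewrite oS ?leq_addr // addKn => -[].
split=> [fgG|nfg]; last first.
  have ua := tower_unbounded tow fgK nfg oS a0.
  exists (place_value a); split=> //; first exact: place_value_chain.
  apply: coarse_iso_trans (coarse_iso_tower tow pE) => //.
  exact: infinite_digits_model.
have [S finS SG] := fgG.
have [k Kk] : exists k, forall g, S g -> K k g.
  apply: finite_set_bound => // [g m m' mm'|g _]; last exact: (tower_cover tow).
  exact: (tower_le_mono tow mm').
have KG g : K k g.
  have : [set: G] g by []; rewrite -SG; apply: generated_min => //.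
  exact: (tower_subgroup tow).
apply: coarse_iso_trans (coarse_iso_tower tow pE) => //.
apply: (@finite_digits_model r o a k) => // j kj.
(* The term [K (r + j)] is already the whole group, whereas a base above 1 would put the digits 0
   and 1 in distinct cosets of it. *)
apply/eqP; rewrite eqn_leq a0 andbT leqNgt; apply/negP => aj.
have rj : (k <= r + j)%N by apply: leq_trans kj (leq_addl _ _).
have S1 : step_range (o (r + j)%N) 1%:Z by rewrite oS ?leq_addr // addKn; exact: digit_nat.
have S0 := step0 (tower_step tow (r + j)%N).
have := step_inj (tower_step tow (r + j)%N) S1 S0.
by move=> /(_ (tower_le_mono tow rj (KG _))).
Qed.

(** * Coarse dimension of the models *)

Lemma zscales_dimP r k : coarse_dim_le (@zscales r) k <-> (r <= k)%N.
Proof.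
split=> [dk|rk]; last exact: coarse_dim_leW rk (zscales_dim_le r).
rewrite leqNgt; apply/negP; case: r dk => // r dk kr.
by apply: (@zscales_dim_gt r); apply: coarse_dim_leW dk; rewrite -ltnS.
Qed.

Lemma zscales_blocks_dimP r A k : divisor_chain A ->
  coarse_dim_le (prod_scales (@zscales r) (block_scales A)) k <-> (r <= k)%N.
Proof.
move=> cA; have cZ := coarse_zscales r; have cB := coarse_block_scales cA.
split=> [|/zscales_dimP]; last first.
  by apply: coarse_dim_le_prod => // n x y z; exact: block_scales_trans.
have cZB := coarse_prod_scales cZ cB => /(coarse_dim_le_embed (f := pair^~ 0%N) cZB) H.
apply/zscales_dimP; apply: H => n; exists n => x y; last by case.
by move=> xy; split=> //; have [Br _ _ _] := cB; exact: Br.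
Qed.

Lemma coordinates_dim k :
  ~ coarse_dim_le (@coordinate_scales (fun=> [set: int])) k.
Proof.
have [f [fC fE]] := embed_coordinates k.+1.
have cS := coarse_coordinate_scales (fun=> [set: int]).
move=> /(coarse_dim_le_embed cS fC fE) /zscales_dimP; by rewrite ltnn.
Qed.

Lemma finite_coarse_rank_dimP (G : groupType) (E : scales G) r k :
  coarse_scales E -> finite_coarse_rank E r -> coarse_dim_le E k <-> (r <= k)%N.
Proof.
move=> cE [fgE nfgE]; have cZ := coarse_zscales r.
have [/fgE iso|/nfgE [A [cA _ iso]]] := pselect (finitely_generated [set: G]).
  by rewrite -zscales_dimP (coarse_dim_le_iso k cZ cE iso).
have cB := coarse_prod_scales cZ (coarse_block_scales cA).
by rewrite -(zscales_blocks_dimP r k cA) (coarse_dim_le_iso k cB cE iso).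
Qed.

Local Close Scope group_scope.

(** * Proper left-invariant metrics *)


Lemma exists_nat_ge (R : realType) (x : R) : exists n : nat, x <= n%:R.
Proof.
exists (Num.bound `|x|); apply: le_trans (ler_norm x) _.
exact: ltW (archi_boundP (normr_ge0 x)).
Qed.

Lemma compact_cluster_seq (R : realType) (X : metricType R) (A : set X)
    (u : nat -> X) : compact A -> (forall n, A (u n)) ->
  exists y, forall e : R, 0 < e -> forall N, exists2 n, (N <= n)%N & mdist y (u n) < e.
Proof.
move=> cA Au; have [|y [_ cly]] := cA (u @ \oo)%classic _.
  by exists 0%N => // n _; exact: Au.
exists y => e e0 N.
have [||z [[n Nn <-] zy]] := cly [set u n | n in [set n | (N <= n)%N]] (ball y e).
- by exists N => // n /= Nn; exists n.
- exact: nbhsx_ballx.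
- by exists n => //; move: zy; rewrite ballEmdist.
Qed.

Lemma mdist_shift (R : realType) (G : metricGroupType R) (x y : G) :
  left_invariant G -> mdist x y = mdist (1%g : G) (x^-1 * y)%g.
Proof. by move=> /(_ x^-1%g x y); rewrite mulVg. Qed.

(** A Baire category argument. If the identity were not isolated, nested closed balls could avoid
    the elements of an enumeration one by one; yet compactness yields a point in all of them. *)
Lemma proper_group_discrete (R : realType) (G : metricGroupType R) :
  countable [set: G] -> left_invariant G -> proper_metric G ->
  exists2 e : R, 0 < e & forall g : G, mdist (1%g : G) g < e -> g = 1%g.
Proof.
move=> /(countable_enumeration (1%g : G)) [g gP] linv propG.
apply: contrapT => nodisc.
have near1 e : 0 < e -> exists2 h : G, h <> 1%g & mdist (1%g : G) h < e.
  move=> e0; apply: contrapT => no; apply: nodisc; exists e => // h he.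
  by apply: contrapT => h1; apply: no; exists h.
(* Each closed ball contains a smaller closed ball that avoids a given point. *)
have /choice [next nextP] : forall z : (G * R) * G, exists w : G * R, 0 < z.1.2 ->
    [/\ 0 < w.2, ~ mdist w.1 z.2 <= w.2 &
        forall y, mdist w.1 y <= w.2 -> mdist z.1.1 y <= z.1.2].
  move=> [[x r] h] /=; have [r0|rn] := ltP 0 r; last by exists (x, r).
  have [xh|/eqP xh] := eqVneq x h; last first.
    have d0 : 0 < mdist x h by rewrite mdist_gt0; apply/eqP.
    exists (x, Num.min r (mdist x h / 2)) => _ /=; split.
    - by rewrite lt_min r0 divr_gt0.
    - by rewrite le_min => /andP[_]; lra.
    - by move=> y; rewrite le_min => /andP[].
  (* The centre itself is to be avoided, so it is first moved by a small element [k]. *)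
  have [k k1 kr] := near1 r r0; pose d := mdist (1%g : G) k.
  have d0 : 0 < d by rewrite mdist_gt0; apply/eqP => /esym.
  have xk : mdist x (x * k)%g = d by rewrite mdist_shift // mulKg.
  exists ((x * k)%g, Num.min (r - d) (d / 2)) => _ /=; split.
  - by rewrite lt_min subr_gt0 kr divr_gt0.
  - by rewrite le_min -xh metric_sym xk => /andP[_]; lra.
  - move=> y; rewrite le_min => /andP[le _].
    by have := metric_triangle x (x * k)%g y; rewrite xk; lra.
pose s := fix s n := if n is m.+1 then next (s m, g m) else ((1%g : G), 1 : R).
have s0 n : 0 < (s n).2.
  by elim: n => //= n IHn; have [] := nextP (s n, g n) IHn.
have nested m n y : (m <= n)%N -> mdist (s n).1 y <= (s n).2 ->
    mdist (s m).1 y <= (s m).2.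
  move=> /subnKC <-; elim: (n - m)%N => [|k IHk]; first by rewrite addn0.
  rewrite addnS => H; apply: IHk.
  by have [_ _] := nextP (s (m + k)%N, g (m + k)%N) (s0 _); apply.
have inB m n : (m <= n)%N -> mdist (s m).1 (s n).1 <= (s m).2.
  by move=> mn; apply: (nested m n) => //; rewrite mdistxx; exact: ltW.
have [y yP] := compact_cluster_seq (propG _ _) (fun n => inB 0%N n (leq0n n)).
have [n gn] := gP y.
have [_ nin _] := nextP (s n, g n) (s0 n); apply: nin.
rewrite -[next _]/(s n.+1) [(_, _).2]/= gn leNgt; apply/negP => lt.
have gap : 0 < mdist (s n.+1).1 y - (s n.+1).2 by rewrite subr_gt0.
have [k nk yk] := yP _ gap n.+1.
have := inB _ _ nk; have := metric_triangle (s n.+1).1 (s k).1 y.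
by rewrite (metric_sym (s k).1 y); lra.
Qed.

Definition metric_scales (R : realType) (X : metricType R) : scales X :=
  fun n x y => mdist x y <= n%:R.

Lemma coarse_metric_scales (R : realType) (X : metricType R) :
  coarse_scales (@metric_scales R X).
Proof.
split=> [n x|n x y xy|m n x y mn xy|m n].
- by rewrite /metric_scales mdistxx.
- by rewrite /metric_scales metric_sym.
- by apply: le_trans xy _; rewrite ler_nat.
- exists (m + n)%N => x y z xy yz; rewrite /metric_scales natrD.
  by apply: le_trans (metric_triangle x y z) _; exact: lerD.
Qed.

(** An infinite ball would contain a sequence of distinct elements with a cluster point. Two of them
    would be at distance less than [e], hence equal by discreteness. *)
Lemma proper_ball_finite (R : realType) (G : metricGroupType R) (r : R) :
  countable [set: G] -> left_invariant G -> proper_metric G ->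
  finite_set [set g : G | mdist (1%g : G) g <= r].
Proof.
move=> cG linv propG; have [e e0 disc] := proper_group_discrete cG linv propG.
apply: contrapT => infA; set A := [set g : G | _] in infA.
have /choice [new newP] : forall q : seq G, exists g, A g /\ g \notin q.
  move=> q; apply: contrapT => no; apply: infA.
  apply: (@sub_finite_set _ _ [set` q]); last by apply/finite_seqP; exists q.
  by move=> g Ag /=; apply: contrapT => /negP gq; apply: no; exists g.
pose q := fix q n := if n is m.+1 then new (q m) :: q m else [::].
have [y yP] := compact_cluster_seq (propG _ _) (fun n => (newP (q n)).1).
have e20 : 0 < e / 2 by rewrite divr_gt0.
have [m _ ym] := yP _ e20 0%N; have [n mn yn] := yP _ e20 m.+1.
have qmn : new (q m) \in q n.
  rewrite -(subnKC mn); elim: (n - m.+1)%N => [|k IHk].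
    by rewrite addn0 /= inE eqxx.
  by rewrite addnS /= inE IHk orbT.
have [_ /negP nin] := newP (q n); apply: nin; rewrite -[X in X \in _](mulVKg (new (q m))).
rewrite (disc ((new (q m))^-1 * new (q n))%g) ?mulg1 // -mdist_shift //.
have := metric_triangle (new (q m)) y (new (q n)).
by rewrite (metric_sym (new (q m)) y); lra.
Qed.

Lemma proper_metric_scales (R : realType) (G : metricGroupType R) :
  countable [set: G] -> left_invariant G -> proper_metric G ->
  proper_scales (@metric_scales R G).
Proof.
move=> cG linv propG; split=> [F finF|n].
  have [|g _|n nP] := @finite_set_bound _ F (fun g n => mdist (1%g : G) g <= n%:R) finF.
  - by move=> g m n mn le; apply: le_trans le _; rewrite ler_nat.
  - exact: exists_nat_ge.
  - by exists n => x y /nP; rewrite -mdist_shift.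
exists [set g : G | mdist (1%g : G) g <= n%:R]; first exact: proper_ball_finite.
by move=> x y; rewrite /metric_scales mdist_shift.
Qed.

(** * From metric notions to scales *)

Lemma mdist_le_diam (R : realType) (X : metricType R) (A : set X) x y :
  A x -> A y -> ((mdist x y)%:E <= diam A)%E.
Proof. by move=> Ax Ay; apply: ereal_sup_ubound; right; exists x => //; exists y. Qed.

Lemma diam_leP (R : realType) (X : metricType R) (A : set X) (r : R) : 0 <= r ->
  (diam A <= r%:E)%E <-> (forall x y, A x -> A y -> mdist x y <= r).
Proof.
move=> r0; split=> [Ar x y Ax Ay|Ar].
  by rewrite -lee_fin; apply: le_trans Ar; exact: mdist_le_diam.
apply: ge_ereal_sup => _ [->|[x Ax [y Ay <-]]]; rewrite lee_fin //.
exact: Ar.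
Qed.

Lemma ereal_lt_nat (R : realType) (x : \bar R) : (x < +oo)%E ->
  exists n : nat, (x <= n%:R%:E)%E.
Proof.
case: x => [r _|//|_]; last by exists 0%N; rewrite leNye.
by have [n rn] := exists_nat_ge r; exists n; rewrite lee_fin.
Qed.

Lemma bornologousP (R : realType) (X Y : metricType R) (f : X -> Y) :
  bornologous f <-> controlled (@metric_scales R X) (@metric_scales R Y) f.
Proof.
split=> [bf n|cf delta].
  have [m mP] := ereal_lt_nat (bf n%:R); exists m => x y xy.
  rewrite /metric_scales -lee_fin; apply: le_trans mP.
  (* Sets of two points suffice to control distances between images. *)
  apply: (@le_trans _ _ (diam (f @` [set x; y]))).
    by apply: mdist_le_diam; [exists x => //; left | exists y => //; right].
  apply: ereal_sup_ubound; exists [set x; y] => //=.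
  apply/diam_leP => // _ _ [->|->] [->|->]; rewrite ?mdistxx //.
  by rewrite metric_sym.
have [n dn] := exists_nat_ge delta; have [m Fm] := cf n.
apply: (@le_lt_trans _ _ m%:R%:E); last by rewrite ltry.
apply: ge_ereal_sup => _ [A Ad <-]; apply/diam_leP => //.
have {}Ad : (diam A <= n%:R%:E)%E by apply: le_trans Ad _; rewrite lee_fin.
move/diam_leP: Ad => /(_ (ler0n _ _)) Ad.
by move=> _ _ [x Ax <-] [y Ay <-]; apply: Fm; exact: Ad.
Qed.

Lemma coarsely_equivalentP (R : realType) (X Y : metricType R) :
  coarsely_equivalent X Y <->
  coarse_iso (@metric_scales R X) (@metric_scales R Y).
Proof.
have [Xr Xs Xm Xc] := coarse_metric_scales X.
have cY := coarse_metric_scales Y; have [Yr Ys Ym Yc] := cY.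
split=> [[f [g [K [/bornologousP fC /bornologousP gC gf fg]]]]|[f [fC fE fB]]].
  have [k Kk] := exists_nat_ge K.
  have gfk x : metric_scales k (g (f x)) x by exact: le_trans (gf x) Kk.
  exists f; split=> //; last first.
    by exists k => y; exists (g y); exact: le_trans (fg y) Kk.
  move=> n; have [m Gm] := gC n; have [a Ha] := Xc k m; have [b Hb] := Xc a k.
  exists b => x y /Gm H; apply: Hb (gfk y); apply: Ha H.
  exact/Xs.
have [k /choice [g fg]] := fB.
have [m Em] := fE k; exists f, g, (maxn k m)%:R; split.
- exact/bornologousP.
- apply/bornologousP => n; have [a Fa] := Yc k n; have [b Fb] := Yc a k.
  have [c Ec] := fE b; exists c => y y' yy'; apply: Ec.
  by apply: Fb (Ys _ _ _ (fg y')); apply: Fa yy'.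
- by move=> x; apply: (Xm m) (Em _ _ (fg _)); exact: leq_maxr.
- by move=> y; apply: (Ym k) (fg y); exact: leq_maxl.
Qed.

Lemma asdim_leP (R : realType) (X : metricType R) k :
  asdim_le X k <-> coarse_dim_le (@metric_scales R X) k.
Proof.
split=> [aX n|dX D D0].
  (* Families that are discrete at [n.+1] are needed: the distance between distinct members has to
     exceed [n], while discreteness is a weak inequality. *)
  have [U [V [covU bndU UV disV]]] := aX n.+1%:R (ler0n _ _).
  have [m mP] := ereal_lt_nat bndU.
  have /choice [B BP] : forall x, exists B, exists i, V i B /\ B x.
    move=> x; have : [set: X] x by []; rewrite -covU UV => -[B [i _ VB] Bx].
    by exists B, i.
  have /choice [c cP] := BP.
  have [s [sB sE]] := fiber_section B.
  exists m, c, s; split=> [x|x y cxy xy].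
    have [VB Bx] := cP x; have [_ Bsx] := cP (s x); rewrite sB in Bsx.
    rewrite /metric_scales -lee_fin; apply: le_trans mP.
    apply: le_trans (mdist_le_diam Bx Bsx) _.
    by apply: ereal_sup_ubound; exists (B x) => //; rewrite UV; exists (c x).
  apply: sE; apply: contrapT => nB; have [VB Bx] := cP x; have [VB' By] := cP y.
  rewrite -cxy in VB'; have := disV _ _ _ VB VB' nB; apply/negP; rewrite -ltNge.
  apply: (@le_lt_trans _ _ (mdist x y)%:E).
    by apply: ereal_inf_lbound; exists x => //; exists y.
  by rewrite lte_fin; apply: le_lt_trans xy _; rewrite ltr_nat.
have [n Dn] := exists_nat_ge D; have [m [c [p [pm pc]]]] := dX n.
(* Pieces consist of the points with a given colour and label; all of them are within [m] of the
   label, so diameters are at most [2 m]. *)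
pose V i := [set [set y | c y = i /\ p y = z] | z in [set: X]].
exists (\bigcup_i V i), V; split=> //.
- rewrite eqEsubset; split=> // x _.
  by exists [set y | c y = c x /\ p y = p x] => //; exists (c x) => //; exists (p x).
- apply: (@le_lt_trans _ _ (m + m)%:R%:E); last by rewrite ltry.
  apply: ge_ereal_sup => _ [A [i _ [z _ <-]] <-]; apply/diam_leP => //.
  move=> x y [_ px] [_ py]; rewrite natrD.
  apply: le_trans (metric_triangle x z y) _; apply: lerD; first by rewrite -px; exact: pm.
  by rewrite -py metric_sym; exact: pm.
- move=> i A B [z _ <-] [w _ <-] AB; apply: le_ereal_inf_tmp => _ [x [cx px] [y [cy py] <-]].
  rewrite lee_fin leNgt; apply/negP => xyD; apply: AB.
  have <- : z = w; last by [].
  rewrite -px -py; apply: pc; first by rewrite cx cy.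
  by apply: ltW; exact: lt_le_trans xyD Dn.
Qed.

Lemma asdim_leW (R : realType) (X : metricType R) k l :
  (k <= l)%N -> asdim_le X k -> asdim_le X l.
Proof. by move=> kl /asdim_leP H; apply/asdim_leP; exact: coarse_dim_leW H. Qed.

Lemma asdim_eqP (R : realType) (X Y : metricType R) :
  asdim X = asdim Y <-> forall k, asdim_le X k <-> asdim_le Y k.
Proof.
have asdimP (Z : metricType R) k : asdim_le Z k <-> exists2 n : nat, asdim Z = n%:E & (n <= k)%N.
  rewrite /asdim; case: pselect => [ex|no]; last first.
    split=> [Zk|[n //]]; case: no; exists k; exact/asboolP.
  case: ex_minnP => m /asboolP Zm mmin; split=> [Zk|[n [<-] mk]].
    by exists m => //; apply: mmin; exact/asboolP.
  exact: asdim_leW Zm.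
split=> [E k|E]; first by rewrite !asdimP E.
have {}E : asdim_le X = asdim_le Y by apply/funext => k; apply/propext.
by rewrite /asdim E.
Qed.

Lemma finitely_generatedP (R : realType) (G : metricGroupType R) :
  left_invariant G -> proper_scales (@metric_scales R G) ->
  finitely_generated [set: G] <-> chain_connected (@metric_scales R G).
Proof.
move=> linv [Efin Eprop]; have [_ Esym _ _] := coarse_metric_scales G.
split=> [[S finS SG]|[n chain]]; last first.
  have [F finF EF] := Eprop n; exists F => //.
  have sF := subgroup_generated F.
  rewrite eqEsubset; split=> // g _.
  apply: (chain 1%g g (generated_subgroup F) (subgroup1 sF)).
  move=> u v Fu /EF Fuv; rewrite -(mulVKg u v).
  exact: subgroupM sF Fu (sub_generated Fuv).
have [n En] := Efin S finS; exists n.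
(* Right multiplication by an element of [A] neither enters nor leaves a set stable under steps of
   scale [n]. The equivalence makes [A] stable under inverses, hence a subgroup. *)
pose A : set G := [set g | forall (P : G -> Prop),
  (forall u v, P u -> metric_scales n u v -> P v) -> forall x, P x <-> P (x * g)%g].
have sA : subgroup A.
  apply/subgroupP; split=> [P _ x|g h Ag Ah P Pstep x]; first by rewrite mulg1.
  by rewrite (Ag P Pstep) (Ah P Pstep (x * (g / h))%g) -mulgA mulgVK.
have SA : S `<=` A.
  move=> s Ss P Pstep x.
  have xs : metric_scales n x (x * s)%g by apply: En; rewrite mulKg.
  by split=> Px; apply: Pstep Px _ => //; exact: Esym.
move=> x y P Px Pstep; have : [set: G] (x^-1 * y)%g by [].
rewrite -SG => gxy; have Axy : A (x^-1 * y)%g by exact: (generated_min sA SA).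
by rewrite -(mulVKg x y) -(Axy P Pstep x).
Qed.

Theorem corollary2 (R : realType) (G H : metricGroupType R)
    (countG : countable [set: G]) (countH : countable [set: H])
    (linvG : left_invariant G) (linvH : left_invariant H)
    (propG : proper_metric G) (propH : proper_metric H)
    (lfaG : locally_finite_by_abelian G) (lfaH : locally_finite_by_abelian H) :
  coarsely_equivalent G H <->
  asdim G = asdim H /\
  ((finitely_generated [set: G] /\ finitely_generated [set: H]) \/
   (~ finitely_generated [set: G] /\ ~ finitely_generated [set: H])).
Proof.
have cG := coarse_metric_scales G; have cH := coarse_metric_scales H.
have pG := proper_metric_scales countG linvG propG.
have pH := proper_metric_scales countH linvH propH.
rewrite coarsely_equivalentP asdim_eqP; split=> [GH|[dimGH fgGH]].
  split=> [k|]; first by rewrite !asdim_leP; exact: coarse_dim_le_iso.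
  rewrite !finitely_generatedP //.
  have [GC|GnC] := pselect (chain_connected (@metric_scales R G)); [left|right].
    by split=> //; exact: chain_connected_iso GH GC.
  by split=> // HC; apply: GnC; exact: chain_connected_iso (coarse_iso_sym cH GH) HC.
have {dimGH} dimGH k : coarse_dim_le (@metric_scales R G) k <->
    coarse_dim_le (@metric_scales R H) k by rewrite -!asdim_leP.
have dimP (K : metricGroupType R) r k (rK : finite_coarse_rank (@metric_scales R K) r) :=
  finite_coarse_rank_dimP k (coarse_metric_scales K) rK.
have infP (K : metricGroupType R) : let E := @metric_scales R K in
    coarse_iso (@coordinate_scales (fun=> setT)) E -> forall k, ~ coarse_dim_le E k.
  move=> E iso k; have cE := coarse_metric_scales K.
  have cS := coarse_coordinate_scales (fun=> [set: int]).
  by rewrite -(coarse_dim_le_iso k cS cE iso); exact: coordinates_dim.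
have [isoG|[r rG]] := coarse_classification lfaG countG cG pG;
have [isoH|[r' rH]] := coarse_classification lfaH countH cH pH.
- exact: coarse_iso_trans cH (coarse_iso_sym cG isoG) isoH.
(* A group coarsely equivalent to the infinite sum of copies of the integers has no finite dimension
   bound, which rules out a partner of finite rank. *)
- by case: (infP G isoG r'); rewrite dimGH (dimP H r' _ rH).
- by case: (infP H isoH r); rewrite -dimGH (dimP G r _ rG).
have rr' : r = r'.
  apply/eqP; rewrite eqn_leq; apply/andP; split.
    exact/(dimP G r _ rG)/dimGH/(dimP H r' _ rH).
  exact/(dimP H r' _ rH)/dimGH/(dimP G r _ rG).
rewrite -{r'}rr' in rH.
case: fgGH => -[fgG fgH].
  exact: coarse_iso_trans cH (coarse_iso_sym cG (rG.1 fgG)) (rH.1 fgH).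
have [A [cA uA isoA]] := rG.2 fgG; have [B [cB uB isoB]] := rH.2 fgH.
have cZ := coarse_zscales r.
have cSA := coarse_block_scales cA; have cSB := coarse_block_scales cB.
apply: (coarse_iso_trans cH (coarse_iso_sym cG isoA)).
apply: (coarse_iso_trans cH _ isoB).
by apply: coarse_iso_prodr => //; exact: coarse_iso_blocks.
Qed.
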